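(* Let $D\in\{7,11,19,43,67,163\}$, let $r$ and $g$ be non-zero integers, and let $E/\mathbb{Q}$ be the elliptic curve $E_{D,g}$ of the context (with CM by $\mathbb{Q}(\sqrt{-D})$). Then $\varpi_{E,r}=\varpi_{E,-r}$ if and only if one of the following holds: - $D\mid r$; - $D=7$, $\gcd(r,14)=1$; - $r\equiv2\ (\mathrm{mod}\ 4)$, $2\nmid\lambda$, $D\nmid r$; - $2\nmid r\lambda$, $D\nmid r$; - $2\nmid r\big(\delta+\mu+\frac{g_1-1}{2}\big)$, $D\nmid r$.
   Context: Curves: $E_{7,g}:y^2=4x^3-\frac{35}{4}g^2x-\frac{49}{8}g^3$; $E_{11,g}:y^2=4x^3-\frac{88}{3}g^2x+\frac{847}{27}g^3$; $E_{19,g}:y^2=4x^3-152g^2x+361g^3$; $E_{43,g}:y^2=4x^3-80\cdot43g^2x+21\cdot43^2g^3$; $E_{67,g}:y^2=4x^3-440\cdot67g^2x+217\cdot67^2g^3$; $E_{163,g}:y^2=4x^3-53360\cdot163g^2x+185801\cdot163^2g^3$. Write $g=(-1)^\delta2^\lambda D^\mu g_1$ with $\delta\in\{0,1\}$, integers $\lambda,\mu\geqslant0$, $g_1\geqslant1$, $\gcd(g_1,2D)=1$. Put $\varpi_{E,r}=0$ if $D\mid r$, and for $D\nmid r$, $\varpi_{E,r}=\frac{h_{D,r}}{2}\big(1+\varepsilon_D(g,r)(\frac{2^{\lambda+1}g_1r}{D})\Omega_2(D;g_1,r)\big)$, where $\Omega_2(D;g_1,r)=\prod_{p^\nu\parallel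 g_1,\ p\nmid r,\ 2\nmid\nu}\frac{-1}{p-1-(\frac{-D}{p})}$ (empty product $=1$) and $\varepsilon_D(g,r)=\frac12(-1)^{\frac{g_1-1}{2}}(1+(-1)^\lambda)$ for $r\equiv2$ mod $4$, $(-1)^{\delta+\mu+\frac{\lambda r}{4}}$ for $4\mid r$, $\frac14(1+(-1)^\lambda)((-1)^{\frac{g_1-1}{2}}+(-1)^{\delta+\mu})$ for $2\nmid r$. Here $h_{D,r}=\xi\frac{\sqrt D}{\varphi(D)}\prod_{p\nmid2r}\big(1-\frac{(\frac{-D}{p})}{p-1}\big)$ with (for $D\nmid r$) $\xi=1$ if $2\mid r$; $\xi=2$ if $2\nmid r$ and $D\equiv3$ mod $8$; $\xi=0$ if $2\nmid r$ and $D=7$. Products over primes in increasing order; $(\frac\cdot\cdot)$ is the Legendre symbol. *)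

(* Defs.v *)
From HB Require Import structures.
From mathcomp Require Import all_boot all_order all_algebra.
From mathcomp Require Import all_classical all_reals all_analysis.
From mathcomp Require Import zify ring lra.

Set Implicit Arguments.
Unset Strict Implicit.
Unset Printing Implicit Defensive.

Import Order.TTheory GRing.Theory Num.Theory.
Import numFieldNormedType.Exports.

Local Open Scope ring_scope.

(* The curve y ^ 2 = 4 x ^ 3 + wA x + wB over the rationals. *)
Record wcurve := WCurve { wA : rat; wB : rat }.

Definition on_wcurve (E : wcurve) (x y : rat) : Prop :=
  y ^+ 2 = 4 * x ^+ 3 + wA E * x + wB E.

(* In terms of g2 = - wA and g3 = - wB, this is g2 ^ 3 - 27 g3 ^ 2 != 0. *)
Definition nonsingular (E : wcurve) : Prop :=
  wA E ^+ 3 + 27 * wB E ^+ 2 != 0.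

Definition cm_discs : seq nat := [:: 7; 11; 19; 43; 67; 163]%N.

(* Numerals are unary here, so 53360 and 185801 are written 533 * 100 + 60 and
   1858 * 100 + 1. *)
Definition cm_A (F : fieldType) (D : nat) : F :=
  if D == 7%N then - (35 / 4)
  else if D == 11%N then - (88 / 3)
  else if D == 19%N then - 152
  else if D == 43%N then - (80 * 43)
  else if D == 67%N then - (440 * 67)
  else if D == 163%N then - ((533 * 100 + 60) * 163)
  else 0.

Definition cm_B (F : fieldType) (D : nat) : F :=
  if D == 7%N then - (49 / 8)
  else if D == 11%N then 847 / 27
  else if D == 19%N then 361
  else if D == 43%N then 21 * 43 ^+ 2
  else if D == 67%N then 217 * 67 ^+ 2
  else if D == 163%N then (1858 * 100 + 1) * 163 ^+ 2
  else 0.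

Definition cm_curve (D : nat) (g : int) : wcurve :=
  WCurve (cm_A rat D * g%:~R ^+ 2) (cm_B rat D * g%:~R ^+ 3).

(* The pair (D, g) such that E = cm_curve D g; it is unique by cm_paramsE. *)
Definition cm_params (E : wcurve) : nat * int :=
  xget (7%N, 1)
    [set Dg : nat * int |
      [/\ Dg.1 \in cm_discs, Dg.2 != 0 & E = cm_curve Dg.1 Dg.2]].

(* The components of g = (-1) ^ delta * 2 ^ lambda * D ^ mu * g1; see
   g_decomp and g_decomp_uniq. *)
Definition g_delta (g : int) : nat := (g < 0)%R.
Definition g_lambda (g : int) : nat := logn 2 `|g|%N.
Definition g_mu (D : nat) (g : int) : nat := logn D `|g|%N.
Definition g_one (D : nat) (g : int) : nat :=
  (`|g| %/ (2 ^ g_lambda g * D ^ g_mu D g))%N.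

Definition legendre (a : int) (p : nat) : int :=
  if (p%:Z %| a)%Z then 0
  else if [exists x : 'I_p, (p%:Z %| (x : nat)%:Z ^+ 2 - a)%Z] then 1
  else -1.

Section Constants.
Variable R : realType.

(* Only meaningful when D does not divide r; the last branch is D = 7. *)
Definition xi (D : nat) (r : int) : R :=
  if (2 %| r)%Z then 1 else if D == 3 %[mod 8] then 2 else 0.

(* The product converges only conditionally, hence the limit of the products
   over the primes below n. *)
Definition h_const (D : nat) (r : int) : R :=
  xi D r * (Num.sqrt D%:R / (totient D)%:R) *
  limn (fun n : nat =>
    \prod_(0 <= p < n | prime p && ~~ (p%:Z %| 2 * r)%Z)
      (1 - (legendre (- D%:Z) p)%:~R / (p%:R - 1) : R)).

Definition Omega2 (D g1 : nat) (r : int) : R :=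
  \prod_(p <- primes g1 | ~~ (p%:Z %| r)%Z && ~~ (2 %| logn p g1)%N)
    (- 1 / (p%:R - 1 - (legendre (- D%:Z) p)%:~R)).

Definition eps (delta lambda mu g1 : nat) (r : int) : R :=
  if (r == 2 %[mod 4])%Z then
    1 / 2 * (-1) ^+ ((g1 - 1) %/ 2) * (1 + (-1) ^+ lambda)
  else if (4 %| r)%Z then
    (-1) ^ (delta%:Z + mu%:Z + (lambda%:Z * r %/ 4)%Z)
  else
    1 / 4 * (1 + (-1) ^+ lambda) *
      ((-1) ^+ ((g1 - 1) %/ 2) + (-1) ^+ (delta + mu)).

Definition varpi (E : wcurve) (r : int) : R :=
  let D := (cm_params E).1 in
  let g := (cm_params E).2 in
  let g1 := g_one D g in
  if (D%:Z %| r)%Z then 0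
  else h_const D r / 2 *
    (1 + eps (g_delta g) (g_lambda g) (g_mu D g) g1 r *
         (legendre (2 ^+ (g_lambda g).+1 * g1%:Z * r) D)%:~R *
         Omega2 D g1 r).

End Constants.

Lemma cm_coef_neq0 (F : realFieldType) (D : nat) : D \in cm_discs ->
  [/\ cm_A F D != 0, cm_B F D != 0 & cm_A F D ^+ 3 + 27 * cm_B F D ^+ 2 != 0].
Proof.
rewrite !inE /cm_A /cm_B.
by case/orP=> [/eqP->|/orP[/eqP->|/orP[/eqP->|/orP[/eqP->|/orP[/eqP->|/eqP->]]]]]
  /=; split; apply/eqP; lra.
Qed.

Lemma cm_coef_inj (F : realFieldType) (D D' : nat) :
  D \in cm_discs -> D' \in cm_discs ->
  cm_A F D ^+ 3 * cm_B F D' ^+ 2 - cm_A F D' ^+ 3 * cm_B F D ^+ 2 = 0 -> D = D'.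
Proof.
rewrite !inE /cm_A /cm_B.
by case/orP=> [/eqP->|/orP[/eqP->|/orP[/eqP->|/orP[/eqP->|/orP[/eqP->|/eqP->]]]]];
  case/orP=> [/eqP->|/orP[/eqP->|/orP[/eqP->|/orP[/eqP->|/orP[/eqP->|/eqP->]]]]]
  //= e; exfalso; lra.
Qed.

Lemma cm_curve_nonsingular (D : nat) (g : int) :
  D \in cm_discs -> g != 0 -> nonsingular (cm_curve D g).
Proof.
move=> hD g0; rewrite /nonsingular [wA _]/(cm_A rat D * g%:~R ^+ 2).
rewrite [wB _]/(cm_B rat D * g%:~R ^+ 3).
have g0' : (g%:~R : rat) != 0 by rewrite intr_eq0.
have [_ _] := cm_coef_neq0 rat hD.
move: (cm_A rat D) (cm_B rat D) => a b ab0.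
have -> : (a * g%:~R ^+ 2) ^+ 3 + 27 * (b * g%:~R ^+ 3) ^+ 2
   = (a ^+ 3 + 27 * b ^+ 2) * (g%:~R : rat) ^+ 6 by ring.
by rewrite mulf_neq0 ?expf_neq0.
Qed.

Lemma cm_curve_inj (D D' : nat) (g g' : int) :
  D \in cm_discs -> D' \in cm_discs -> g != 0 -> g' != 0 ->
  cm_curve D g = cm_curve D' g' -> D = D' /\ g = g'.
Proof.
move=> hD hD' g0 g0' [eA eB].
have G0 : (g%:~R : rat) != 0 by rewrite intr_eq0.
have G0' : (g'%:~R : rat) != 0 by rewrite intr_eq0.
have eD : D = D'.
  apply: (@cm_coef_inj rat) => //.
  move: eA eB G0 G0'; move: (cm_A rat D) (cm_A rat D') => a a'.
  move: (cm_B rat D) (cm_B rat D') => b b'.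
  move: (g%:~R : rat) (g'%:~R : rat) => G G' eA eB G0 G0'.
  have : (a ^+ 3 * b' ^+ 2 - a' ^+ 3 * b ^+ 2) * (G ^+ 6 * G' ^+ 6) = 0.
    have -> : (a ^+ 3 * b' ^+ 2 - a' ^+ 3 * b ^+ 2) * (G ^+ 6 * G' ^+ 6) =
      (a * G ^+ 2) ^+ 3 * (b' * G' ^+ 3) ^+ 2 -
      (a' * G' ^+ 2) ^+ 3 * (b * G ^+ 3) ^+ 2 by ring.
    by rewrite eA eB subrr.
  by move/eqP; rewrite mulf_eq0 [X in _ || X]negbTE ?orbF => [/eqP //|];
    rewrite mulf_neq0 // expf_neq0.
split=> //; apply: (@intr_inj rat); subst D'.
have [a0 b0 _] := cm_coef_neq0 rat hD.
move: (cm_A rat D) (cm_B rat D) a0 b0 eA eB => a b a0 b0.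
move=> /(mulfI a0) e2 /(mulfI b0).
by rewrite !(exprS _ 2) e2 => /mulIf; apply; rewrite expf_neq0.
Qed.

Lemma cm_paramsE (D : nat) (g : int) :
  D \in cm_discs -> g != 0 -> cm_params (cm_curve D g) = (D, g).
Proof.
move=> hD g0; rewrite /cm_params; case: xgetP => [[D' g'] _ /= [hD' g0' e]|].
  by have [-> ->] := cm_curve_inj hD hD' g0 g0' e.
by move=> /(_ (D, g)) [].
Qed.

Lemma cm_disc_prime (D : nat) : D \in cm_discs -> prime D && odd D.
Proof.
rewrite !inE.
by case/orP=> [/eqP->|/orP[/eqP->|/orP[/eqP->|/orP[/eqP->|/orP[/eqP->|/eqP->]]]]].
Qed.

Lemma g_decomp_uniq (D : nat) (g : int) (delta lambda mu g1 : nat) :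
  D \in cm_discs -> (delta <= 1)%N -> (1 <= g1)%N -> coprime g1 (2 * D) ->
  g = (-1) ^+ delta * 2 ^+ lambda * D%:Z ^+ mu * g1%:Z ->
  [/\ delta = g_delta g, lambda = g_lambda g, mu = g_mu D g & g1 = g_one D g].
Proof.
move=> /cm_disc_prime /andP[pD oD] d1 g1p cop eg.
move: cop; rewrite coprimeMr => /andP[c2 cD].
have D0 : (0 < D)%N by apply: prime_gt0.
have eabs : `|g|%N = (2 ^ lambda * D ^ mu * g1)%N.
  by rewrite eg !abszM !abszX /= exp1n mul1n.
have elam : lambda = g_lambda g.
  rewrite /g_lambda eabs !lognM ?muln_gt0 ?expn_gt0 ?D0 //.
  rewrite lognX (lognX _ _ mu) (@logn_coprime 2 D) ?coprime2n //.
  by rewrite (@logn_coprime 2 g1) 1?coprime_sym // logn_prime //= muln1 muln0 !addn0.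
have emu : mu = g_mu D g.
  rewrite /g_mu eabs !lognM ?muln_gt0 ?expn_gt0 ?D0 //.
  rewrite lognX (lognX _ _ mu) (@logn_coprime D 2) ?coprimen2 //.
  by rewrite (@logn_coprime D g1) 1?coprime_sym // logn_prime // eqxx muln1 muln0 addn0.
split=> //.
- have pos : (0 : int) < 2 ^+ lambda * D%:Z ^+ mu * g1%:Z.
    by rewrite !mulr_gt0 ?exprn_gt0 // ltz_nat.
  move: d1 eg; rewrite /g_delta; case: delta => [|[|//]] _ ->.
    by rewrite expr0 mul1r ltNge (ltW pos).
  by rewrite expr1 -!mulrA mulN1r oppr_lt0 mulrA pos.
- by rewrite /g_one -elam -emu eabs mulKn // muln_gt0 !expn_gt0 D0.
Qed.

Lemma g_decomp (D : nat) (g : int) : D \in cm_discs -> g != 0 ->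
  [/\ (g_delta g <= 1)%N, (1 <= g_one D g)%N, coprime (g_one D g) (2 * D) &
      g = (-1) ^+ g_delta g * 2 ^+ g_lambda g * D%:Z ^+ g_mu D g
          * (g_one D g)%:Z].
Proof.
move=> hD g0; have /andP[pD oD] := cm_disc_prime hD.
have a0 : (0 < `|g|)%N by rewrite absz_gt0.
have [m c2 e2] := pfactor_coprime (isT : prime 2) a0.
have m0 : (0 < m)%N by move: a0; rewrite e2 muln_gt0 => /andP[].
have [k cD eD] := pfactor_coprime pD m0.
have k0 : (0 < k)%N by move: m0; rewrite eD muln_gt0 => /andP[].
have c2k : coprime k 2.
  by move: c2; rewrite eD coprimeMr coprime_sym => /andP[].
have eg : g = (-1) ^+ g_delta g * 2 ^+ g_lambda g * D%:Z ^+ (logn D m) * k%:Z.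
  rewrite {1}(intEsign g) -!mulrA; congr (_ * _).
  have -> : `|g|%N = (2 ^ g_lambda g * (D ^ logn D m * k))%N.
    by rewrite {1}e2 {1}eD /g_lambda mulnC (mulnC k).
  by rewrite !PoszM -!natz !natrX.
have d1 : (g_delta g <= 1)%N by rewrite leq_b1.
have cop : coprime k (2 * D) by rewrite coprimeMr c2k coprime_sym.
have [_ _ emu ek] := g_decomp_uniq hD d1 k0 cop eg.
by rewrite -emu -ek.
Qed.

(* Main.v *)
(** The symbol of [- r] is minus the symbol of [r] modulo [D], as [D = 3 mod 4], and the
    other ingredients of [varpi] are even in [r]; so the two constants agree iff
    [h_const * eps = 0].  The main point is that the conditionally convergent product in
    [h_const] has a nonzero limit.  By quadratic reciprocity (Gauss sums) its character is
    [chi n = (n / D)], whose partial sums are bounded.  Then [L = sum chi(n) / n] is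
    nonzero by Monsky's Lambert series argument, Mertens' method with Chebyshev's bound on
    [psi] gives [sum_(p <= N) chi(p) ln p / p = O(1)], Abel summation makes
    [sum chi(p) / p] converge, and the logarithm of the product differs from minus this
    series by an absolutely convergent one. *)

Require Import Defs.
From mathcomp Require Import all_boot all_order all_algebra.
From mathcomp Require Import fingroup pgroup cyclic finfield.
From mathcomp Require Import all_classical all_reals all_analysis.
From mathcomp Require Import zify ring lra.

Import Order.TTheory GRing.Theory Num.Theory.

Import numFieldNormedType.Exports.
Local Open Scope ring_scope.

(** * The Legendre symbol *)

(** The constant [xi] for odd [r] is the factor [1 - (-D/2) / (2 - 1)] that the product omits: with
    the Kronecker symbol at [2] it is [0] for [D = 7] and [2] for [D = 3] modulo [8]. The primes
    [p > 2] have factors at least [1/2], so [2] is the only place where a local factor can vanish.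
    Nonzero factors alone prove nothing about the limit: without convergence the value of [limn]
    carries no information, and a conditionally convergent product could still tend to [0].
    Reciprocity is needed because [(-D/p)] has the variable [p] as its modulus, which hides the
    periodicity in [p] on which every cancellation rests. Since the character is real, nonvanishing
    of [L] is the delicate case; Monsky's argument settles it with inequalities between finite sums
    and limits over the reals only. *)

Lemma legendreE (p : nat) (a : int) : prime p ->
  legendre a p = if a%:~R == 0 :> 'F_p then 0
                 else if [exists x : 'F_p, x ^+ 2 == a%:~R] then 1 else -1.
Proof.
move=> pr; have dvdE := dvdz_pcharf (pchar_Fp pr).
rewrite /legendre dvdE; case: ifP => // _.
congr (if _ then _ else _); apply/existsP/existsP=> [[x]|[x /eqP hx]].
  rewrite dvdE rmorphB rmorphXn /= subr_eq0 => h.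
  by exists (nat_of_ord x)%:R.
have xlt : (x < p)%N by rewrite -[X in (_ < X)%N](Fp_cast pr).
exists (Ordinal xlt); rewrite dvdE rmorphB rmorphXn /= subr_eq0.
by rewrite -pmulrn natr_Zp hx.
Qed.

Lemma half_pred_double (p : nat) : prime p -> (2 < p)%N -> p.-1./2.*2 = p.-1.
Proof.
move=> pr p2; have := odd_double_half p.-1.
by case: (even_prime pr) p2 => [->//|op] p2; lia.
Qed.

Lemma finField_cyclicP (F : finFieldType) : exists g : F,
  (forall x : F, x != 0 -> exists k, x = g ^+ k) /\
  (forall m, g ^+ m = 1 -> (#|F|.-1 %| m)%N).
Proof.
have /cyclicP[g hg] := field_unit_group_cyclic [set: {unit F}]%G.
exists (val g); split=> [x x0|m].
  have xu : x \is a GRing.unit by rewrite unitfE.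
  have : FinRing.unit F xu \in <[g]>%g by rewrite -hg inE.
  case/cycleP => k hk; exists k.
  by have := congr1 val hk; rewrite /= FinRing.val_unitX.
rewrite -card_finField_unit hg -/(order g) order_dvdn -FinRing.val_unitX => e.
by apply/eqP/val_inj.
Qed.

(** By Fermat the power is [1] on nonzero squares and [1] or [-1] on every unit. If it were [1] at a
    nonsquare [g ^ k], with [g] a generator, then [p - 1] would divide [k (p - 1) / 2], so [k] would
    be even. *)
Lemma euler_criterion (p : nat) (a : int) : prime p -> (2 < p)%N ->
  (p%:Z %| a ^+ p.-1./2 - legendre a p)%Z.
Proof.
move=> pr p2; rewrite (dvdz_pcharf (pchar_Fp pr)) rmorphB rmorphXn /= subr_eq0.
rewrite (legendreE _ _ pr); move: (a%:~R : 'F_p) => {}a.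
have h2 := half_pred_double _ pr p2.
have fermat (x : 'F_p) : x != 0 -> x ^+ p.-1 = 1.
  move=> x0; have := expf_card x.
  rewrite card_Fp // => e.
  by apply: (mulfI x0); rewrite -exprS prednK ?prime_gt0 // e mulr1.
case: (a =P 0) => [->|/eqP a0].
  by rewrite expr0n; have -> : (p.-1./2 == 0)%N = false by lia.
case: existsP => [[x /eqP hx]|nx].
  have x0 : x != 0 by apply: contraNneq a0 => x0; rewrite -hx x0 expr0n.
  by rewrite -hx -exprM mulnC muln2 h2 fermat.
have : (a ^+ p.-1./2) ^+ 2 = 1 by rewrite -exprM muln2 h2 fermat.
move=> /eqP; rewrite sqrf_eq1 => /orP[/eqP e|/eqP -> //].
have [g [gen ord]] := finField_cyclicP 'F_p.
have [k ek] := gen a a0; case: nx; exists (g ^+ k./2).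
move: e; rewrite {1}ek -exprM => /ord; rewrite card_Fp // => /dvdnP[j ej].
have {}ej : k = (j * 2)%N.
  have : (k * p.-1./2 == j * 2 * p.-1./2)%N by apply/eqP; rewrite ej -mulnA mul2n h2.
  by rewrite eqn_mul2r; have -> : (p.-1./2 == 0)%N = false by [lia]; move/eqP.
by rewrite ek ej -exprM !muln2 doubleK.
Qed.

Lemma legendre_cases (a : int) (p : nat) :
  [\/ legendre a p = 0, legendre a p = 1 | legendre a p = -1].
Proof.
by rewrite /legendre; case: ifP => _; [constructor 1|case: ifP => _; [constructor 2|constructor 3]].
Qed.

Lemma legendre_eq0 (a : int) (p : nat) : (legendre a p == 0) = (p%:Z %| a)%Z.
Proof. by rewrite /legendre; case: ifP => // _; case: ifP. Qed.

Lemma legendre_mod (a b : int) (p : nat) : prime p ->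
  (p%:Z %| a - b)%Z -> legendre a p = legendre b p.
Proof.
move=> pr; rewrite (dvdz_pcharf (pchar_Fp pr)) rmorphB /= subr_eq0 => /eqP e.
by rewrite !legendreE // e.
Qed.

(** Two symbol values differ by at most [2], so for odd [p] a congruence between them modulo [p] is
    an equality. *)
Lemma small_dvdz (p : nat) (x : int) : (2 < p)%N -> (p%:Z %| x)%Z ->
  `|x| <= 2 -> x = 0.
Proof.
move=> p2 /dvdzP[k ->] h; have : k = 0 by nia.
by move->; rewrite mul0r.
Qed.

Lemma legendreM (a b : int) (p : nat) : prime p -> (2 < p)%N ->
  legendre (a * b) p = legendre a p * legendre b p.
Proof.
move=> pr p2; apply/eqP; rewrite -subr_eq0; apply/eqP.
apply: (small_dvdz _ _ p2); last first.
  by case: (legendre_cases (a * b) p) => ->; case: (legendre_cases a p) => ->;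
    case: (legendre_cases b p) => ->.
have dvdE := dvdz_pcharf (pchar_Fp pr).
have e c : (c ^+ p.-1./2)%:~R = (legendre c p)%:~R :> 'F_p.
  by apply/eqP; rewrite -subr_eq0 -rmorphB -dvdE euler_criterion.
by rewrite dvdE rmorphB rmorphM /= -!e exprMn rmorphM subrr.
Qed.

Lemma legendreN (a : int) (p : nat) : prime p -> (p = 3 %[mod 4])%N ->
  legendre (- a) p = - legendre a p.
Proof.
move=> pr p4; have p2 : (2 < p)%N by lia.
rewrite -mulN1r legendreM //; suff -> : legendre (-1) p = -1 by rewrite mulN1r.
have := euler_criterion p (-1) pr p2.
have -> : p.-1./2 = (p %/ 4).*2.+1 by lia.
rewrite exprS -signr_odd odd_double expr0 mulr1.
case: (legendre_cases (-1) p) => -> // /(small_dvdz _ _ p2) h; first by have := h isT.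
by have := h isT.
Qed.

Lemma legendre1 (p : nat) : prime p -> legendre 1 p = 1.
Proof.
move=> pr; rewrite legendreE // oner_eq0; case: existsP => // -[].
by exists 1; rewrite expr1n.
Qed.

(** * Quadratic reciprocity by Gauss sums *)

(** By Fermat [q] divides [p ^ (q - 1) - 1], the order of the unit group of the field with
    [p ^ (q - 1)] elements; Cauchy's theorem then provides an element of order [q]. *)
Lemma root_of_unity_ext (p q : nat) : prime p -> prime q -> p != q ->
  exists (K : finFieldType) (z : K), [/\ p \in [pchar K], z != 1 & z ^+ q = 1].
Proof.
move=> pp pq npq.
have q1 : (0 < q.-1)%N by have := prime_gt1 pq; lia.
have [K chK cK] := pPrimePowerField pp q1.
have cop : coprime p q by rewrite prime_coprime // dvdn_prime2.
have qd : (q %| #|[set: {unit K}]|)%N.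
  rewrite card_finField_unit cK -subn1 -eqn_mod_dvd ?expn_gt0 ?prime_gt0 //.
  by apply/eqP; rewrite -(totient_prime pq) Euler_exp_totient.
have [x _ ox] := Cauchy pq qd.
exists K, (val x); split=> //.
  apply: contraTneq (prime_gt1 pq) => x1.
  by rewrite -ox (_ : x = 1%g) ?order1 //; apply: val_inj.
by rewrite -FinRing.val_unitX -ox expg_order.
Qed.

Section GaussSum.

Variables (q : nat) (K : finFieldType) (z : K).
Hypotheses (pq : prime q) (q4 : (q = 3 %[mod 4])%N) (z1 : z != 1) (zq : z ^+ q = 1).

(** [e] is an additive character, [c] the quadratic character and [tau] their Gauss sum. Values in
    [K] rather than in the complex numbers let the [p]-th power act as the Frobenius when [K] has
    characteristic [p]. *)
Let e (a : 'F_q) : K := z ^+ (a : nat).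
Let c (a : 'F_q) : K := (legendre (a : nat)%:Z q)%:~R.
Let tau : K := \sum_a c a * e a.

Let q2 : (2 < q)%N. Proof. by lia. Qed.

Let e_nat (n : nat) : e n%:R = z ^+ n.
Proof. by rewrite /e val_Fp_nat // expr_mod. Qed.

Let eD (a b : 'F_q) : e (a + b) = e a * e b.
Proof. by rewrite -[a]natr_Zp -[b]natr_Zp -natrD !e_nat exprD. Qed.

Let c_nat (n : nat) : c n%:R = (legendre n%:Z q)%:~R.
Proof.
rewrite /c val_Fp_nat //; congr (_%:~R); apply: legendre_mod => //.
by rewrite (dvdz_pcharf (pchar_Fp pq)) rmorphB /= -!pmulrn Fp_nat_mod // subrr.
Qed.

Let cM (a b : 'F_q) : c (a * b) = c a * c b.
Proof.
by rewrite -[a]natr_Zp -[b]natr_Zp -natrM !c_nat PoszM legendreM // intrM.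
Qed.

Let c0 : c 0 = 0.
Proof. by rewrite (c_nat 0); have /eqP -> : legendre 0 q == 0 by rewrite legendre_eq0. Qed.

Let cN1 : c (-1) = -1.
Proof.
have -> : -1 = (q.-1)%:R :> 'F_q.
  apply/eqP; rewrite eq_sym -addr_eq0 -[X in _ + X]/(1%:R) -natrD addn1 prednK ?prime_gt0 //.
  by rewrite pchar_Fp_0.
rewrite c_nat (_ : legendre _ _ = -1) //.
rewrite -(legendre1 _ pq) -legendreN //; apply: legendre_mod => //.
have -> : (q.-1)%:Z - -1 = q%:Z by lia.
by [].
Qed.

Let c_sqr (a : 'F_q) : a != 0 -> c a ^+ 2 = 1.
Proof.
move=> a0; rewrite -[a]natr_Zp c_nat.
have : legendre (a : nat)%:Z q != 0.
  by rewrite legendre_eq0 (dvdz_pcharf (pchar_Fp pq)) -pmulrn natr_Zp.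
by case: (legendre_cases (a : nat)%:Z q) => -> // _; rewrite ?rmorphN ?sqrrN expr1n.
Qed.

Let sum_c : \sum_a c a = 0.
Proof.
rewrite -rmorph_sum /=; set S := \sum_a _.
suff -> : S = 0 by [].
have : S = - S.
  rewrite /S {1}(reindex_inj oppr_inj) -sumrN; apply: eq_bigr => a _ /=.
  rewrite -legendreN //; apply: legendre_mod => //.
  rewrite (dvdz_pcharf (pchar_Fp pq)) opprK rmorphD /= -!pmulrn.
  by rewrite natr_Zp (natr_Zp (- a)) addNr.
by lia.
Qed.

Let sum_e (b : 'F_q) : \sum_a e (a * b) = if b == 0 then q%:R else 0.
Proof.
case: eqP => [->|/eqP b0].
  under eq_bigr => a _ do rewrite mulr0 (e_nat 0) expr0.
  by rewrite sumr_const card_Fp.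
have -> : \sum_a e (a * b) = \sum_a e a by rewrite [RHS](reindex_inj (mulIf b0)).
have : (\sum_a e a) * (z - 1) = 0.
  rewrite mulrBr mulr1 mulr_suml [X in _ - X](reindex_inj (addIr 1)) /=.
  have e1 : e 1 = z by rewrite (e_nat 1) expr1.
  by under [X in _ - X]eq_bigr => a _ do rewrite eD e1; rewrite subrr.
by move/eqP; rewrite mulf_eq0 subr_eq0 (negPf z1) orbF => /eqP.
Qed.

(** Writing the second index as [a t] leaves, for each [t], the sum of [e (a (1 + t))] over
    [a != 0]: [q - 1] at [t = -1] and [-1] elsewhere. The [-1] terms cancel because [c] sums to [0],
    so [q c(-1) = -q] remains. *)
Lemma gauss_sum_sqr : tau ^+ 2 = - q%:R.
Proof.
have -> : tau ^+ 2 = \sum_a \sum_t c a ^+ 2 * c t * e (a * (1 + t)).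
  rewrite expr2 {1}/tau mulr_suml; apply: eq_bigr => a _.
  have [->|a0] := eqVneq a 0.
    by rewrite c0 !mul0r big1 // => t _; rewrite expr0n !mul0r.
  rewrite mulr_sumr (reindex_inj (mulfI a0)); apply: eq_bigr => t _ /=.
  by rewrite cM mulrDr mulr1 eD; ring.
rewrite exchange_big /=.
have -> : \sum_t \sum_a c a ^+ 2 * c t * e (a * (1 + t)) =
          \sum_t (c t * (if t == -1 then q%:R else 0) - c t).
  apply: eq_bigr => t _.
  have -> : (t == -1) = (1 + t == 0) by rewrite addrC addr_eq0.
  rewrite -sum_e (bigD1 0) //= [X in _ = _ * X - _](bigD1 0) //=.
  rewrite c0 expr0n !mul0r add0r (e_nat 0) mulrDr mulr1 addrAC subrr add0r mulr_sumr.
  by apply: eq_bigr => a a0; rewrite c_sqr // mul1r.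
rewrite sumrB sum_c subr0 (bigD1 (-1)) //= eqxx big1 ?addr0 ?cN1 ?mulN1r //.
by move=> t /negPf ->; rewrite mulr0.
Qed.

(** Frobenius fixes the values [0], [1], [-1] of [c] and turns [e a] into [e (p a)]; the change of
    variable [a -> a p] costs the factor [c p], which is its own inverse. *)
Lemma gauss_sum_frobenius (p : nat) : p \in [pchar K] -> p != q ->
  (2 < p)%N -> tau ^+ p = (legendre p%:Z q)%:~R * tau.
Proof.
move=> chp npq p2; have pp := pcharf_prime chp.
have P0 : (p%:R : 'F_q) != 0.
  by rewrite -(dvdn_pcharf (pchar_Fp pq)) dvdn_prime2 // eq_sym.
rewrite -c_nat -(pFrobenius_autE chp) rmorph_sum /=.
rewrite mulr_sumr [RHS](reindex_inj (mulIf P0)).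
apply: eq_bigr => a _ /=; rewrite pFrobenius_autE exprMn.
rewrite cM mulrA mulrCA -expr2 c_sqr // mulr1; congr (_ * _).
  have -> : p = p./2.*2.+1.
    by have := odd_double_half p; case: (even_prime pp) p2 => [->//|->].
  rewrite /c exprS -muln2 mulnC exprM.
  by case: (legendre_cases a q) => ->; rewrite ?mul0r // ?rmorphN ?sqrrN !expr1n mulr1.
by rewrite -[a in RHS]natr_Zp -natrM e_nat /e -exprM.
Qed.

End GaussSum.

(* With [tau] the Gauss sum in an extension of [F_p], both Euler's criterion and the
   Frobenius evaluate [tau ^ p]. *)
Lemma legendre_reciprocity (p q : nat) : prime p -> (2 < p)%N ->
  prime q -> (q = 3 %[mod 4])%N -> legendre (- q%:Z) p = legendre p%:Z q.
Proof.
move=> pp p2 pq q4; have [<-|npq] := eqVneq p q.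
  have /eqP -> : legendre (- p%:Z) p == 0 by rewrite legendre_eq0 dvdzE abszN.
  by apply/esym/eqP; rewrite legendre_eq0.
have [K [z [chp z1 zq]]] := root_of_unity_ext _ _ pp pq npq.
have dvdE := dvdz_pcharf chp.
have sqr := gauss_sum_sqr q K z pq q4 z1 zq.
have := gauss_sum_frobenius q K z pq q4 z1 zq p chp npq p2.
set tau := \sum_a _ in sqr *; set lp := legendre p q.
have {1}-> : p = (p.-1./2 * 2).+1 by have := half_pred_double _ pp p2; lia.
rewrite exprS mulnC exprM sqr => e.
have qK : (q%:R : K) != 0 by rewrite -(dvdn_pcharf chp) dvdn_prime2.
have tau0 : tau != 0.
  by apply: contraNneq qK => t0; rewrite -oppr_eq0 -sqr t0 expr0n.
apply/eqP; rewrite -subr_eq0; apply/eqP; apply: (small_dvdz p) => //; last first.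
  by rewrite /lp; case: (legendre_cases (- q%:Z) p) => ->; case: (legendre_cases p q) => ->.
have := euler_criterion p (- q%:Z) pp p2.
rewrite !dvdE !rmorphB !subr_eq0 rmorphXn /= rmorphN /= -pmulrn => /eqP <-.
by apply/eqP/(mulfI tau0); rewrite e mulrC.
Qed.

(** * Divisor sums *)

(** Each step strips the full power of one prime, which is the induction suited to divisor sums of
    multiplicative functions and of von Mangoldt's function. *)
Lemma pfactor_ind (P : nat -> Prop) : P 1%N ->
  (forall p k m, prime p -> (0 < k)%N -> coprime p m -> (0 < m)%N -> P m ->
    P (p ^ k * m)%N) ->
  forall n, (0 < n)%N -> P n.
Proof.
move=> P1 PM n; have [N] := ubnP n; elim: N n => // N IH n nN n0.
have [n1|n1] := leqP n 1; first by have -> : n = 1%N by lia.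
have pr := pdiv_prime n1; have [m cop e] := pfactor_coprime pr n0.
have m0 : (0 < m)%N by move: n0; rewrite e muln_gt0 => /andP[].
have k0 : (0 < logn (pdiv n) n)%N by rewrite logn_gt0 mem_primes pr n0 pdiv_dvd.
have P1k : (1 < pdiv n ^ logn (pdiv n) n)%N.
  by rewrite -(exp1n (logn (pdiv n) n)) ltn_exp2r // prime_gt1.
rewrite e mulnC; apply: PM => //; apply: IH => //.
have mn : (m < n)%N by rewrite [X in (_ < X)%N]e ltn_Pmulr.
lia.
Qed.

Lemma sum_divisors_pfactor (V : nmodType) (F : nat -> V) (p k m : nat) :
  prime p -> coprime p m -> (0 < m)%N ->
  \sum_(d <- divisors (p ^ k * m)) F d =
  \sum_(0 <= i < k.+1) \sum_(e <- divisors m) F (p ^ i * e)%N.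
Proof.
move=> pr cop m0; rewrite /index_iota subn0 -big_allpairs_dep.
have pm0 : (0 < p ^ k * m)%N by rewrite muln_gt0 expn_gt0 prime_gt0.
have logM i e : (e %| m)%N -> logn p (p ^ i * e) = i.
  move=> em; have e0 : (0 < e)%N := dvdn_gt0 m0 em.
  have pi0 : (0 < p ^ i)%N by rewrite expn_gt0 prime_gt0.
  rewrite lognM // pfactorK // logn_coprime ?addn0 //.
  exact: coprime_dvdr cop.
apply: perm_big; apply: uniq_perm; first exact: divisors_uniq.
  apply: allpairs_uniq; rewrite ?iota_uniq ?divisors_uniq //.
  move=> _ _ /allpairsP[[i e] [_ he ->]] /allpairsP[[j f] [_ hf ->]] /= E.
  rewrite /= in he hf; rewrite -!dvdn_divisors // in he hf.
  have ij : i = j by rewrite -(logM i e) // E logM.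
  move: E; rewrite ij => /eqP; rewrite eqn_pmul2l ?expn_gt0 ?prime_gt0 //.
  by move/eqP ->.
move=> d; rewrite -dvdn_divisors //; apply/idP/allpairsP => [dv|[[i e] []]].
  have d0 := dvdn_gt0 pm0 dv; have [e ce ed] := pfactor_coprime pr d0.
  exists (logn p d, e); split; last by rewrite /= mulnC.
    rewrite mem_iota add0n ltnS -(logM k m) //.
    exact: dvdn_leq_log.
  rewrite -dvdn_divisors //= -(@Gauss_dvdr _ (p ^ k)); last first.
    by rewrite coprime_sym coprimeXl.
  by apply: dvdn_trans dv; rewrite [X in (_ %| X)%N]ed dvdn_mulr.
rewrite mem_iota ltnS -dvdn_divisors //= => ik em ->.
by rewrite dvdn_mul // dvdn_exp2l.
Qed.

Lemma sum_multiples (V : nmodType) (G : nat -> V) (d N : nat) : (0 < d)%N ->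
  \sum_(1 <= n < N.+1 | (d %| n)%N) G n = \sum_(1 <= m < (N %/ d).+1) G (d * m)%N.
Proof.
move=> d0; elim: N => [|N IH]; first by rewrite div0n !big_geq.
rewrite big_mkcond big_nat_recr //= -big_mkcond IH divnS //.
case: ifP => dN /=; last by rewrite addr0 add0n.
rewrite add1n [RHS]big_nat_recr //=; congr (_ + G _).
by rewrite -{1}(divnK dN) divnS // dN add1n mulnC.
Qed.

(** Both sides run over the pairs [(d, m)] of positive integers with [d m <= N]. *)
Lemma sum_divisors_exchange (V : nmodType) (F : nat -> nat -> V) (N : nat) :
  \sum_(1 <= n < N.+1) \sum_(d <- divisors n) F d (n %/ d)%N =
  \sum_(1 <= d < N.+1) \sum_(1 <= m < (N %/ d).+1) F d m.
Proof.
transitivity (\sum_(1 <= n < N.+1) \sum_(1 <= d < N.+1 | (d %| n)%N) F d (n %/ d)%N).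
  apply: eq_big_nat => n /andP[n1 nN]; rewrite -[RHS]big_filter.
  apply: perm_big; apply: uniq_perm; rewrite ?divisors_uniq ?filter_uniq ?iota_uniq //.
  move=> d; rewrite -dvdn_divisors // mem_filter mem_index_iota.
  case dn: (d %| n)%N => //=; have := dvdn_leq n1 dn; have := dvdn_gt0 n1 dn; lia.
rewrite (exchange_big_dep_nat predT) //=; apply: eq_big_nat => d /andP[d0 _].
rewrite sum_multiples //; apply: eq_bigr => m _; by rewrite mulKn.
Qed.

Section QuadraticDivisorSum.

Variables (R : realDomainType) (chi : nat -> R).
Hypotheses (chi1 : chi 1%N = 1) (chiM : forall m n, chi (m * n)%N = chi m * chi n)
  (chi_val : forall n, [\/ chi n = 0, chi n = 1 | chi n = -1]).

Let chiX (m i : nat) : chi (m ^ i)%N = chi m ^+ i.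
Proof. by elim: i => // i IH; rewrite expnS chiM IH exprS. Qed.

Let sumM (p k m : nat) : prime p -> coprime p m -> (0 < m)%N ->
  \sum_(d <- divisors (p ^ k * m)) chi d =
  (\sum_(0 <= i < k.+1) chi p ^+ i) * \sum_(d <- divisors m) chi d.
Proof.
move=> pr cop m0; rewrite sum_divisors_pfactor // mulr_suml.
apply: eq_bigr => i _; rewrite mulr_sumr; apply: eq_bigr => e _.
by rewrite chiM chiX.
Qed.

(** According to [chi p = 0], [1] or [-1] the sum is [1], the number of terms, or its parity. An
    even exponent gives an odd number of terms, hence the lower bound at squares. *)
Let sum_pow (p k : nat) :
  0 <= \sum_(0 <= i < k.+1) chi p ^+ i /\ 1 <= \sum_(0 <= i < (k.*2).+1) chi p ^+ i.
Proof.
have [->|->|->] := chi_val p.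
- have e n : \sum_(0 <= i < n.+1) (0 : R) ^+ i = 1.
    by rewrite big_nat_recl // expr0 big1 ?addr0 // => i _; rewrite exprS mul0r.
  by rewrite !e ler01.
- have e n : \sum_(0 <= i < n) (1 : R) ^+ i = n%:R.
    by under eq_bigr do rewrite expr1n; rewrite sumr_const_nat subn0.
  by rewrite !e ler0n ler1n.
- have e n : \sum_(0 <= i < n) (-1 : R) ^+ i = (odd n)%:R.
    elim: n => [|n IH]; first by rewrite big_geq.
    rewrite big_nat_recr //= IH -signr_odd.
    by case: (odd n); rewrite /= ?expr0 ?expr1 ?addrN ?add0r.
  by rewrite !e /= odd_double; split=> //; case: (odd k).
Qed.

Lemma sum_divisors_ge0 (n : nat) : (0 < n)%N -> 0 <= \sum_(d <- divisors n) chi d.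
Proof.
elim/pfactor_ind: n / => [|p k m pr _ cop m0 IH].
  by rewrite [divisors 1]/= big_seq1 chi1.
by rewrite sumM // mulr_ge0 //; case: (sum_pow p k).
Qed.

Lemma sum_divisors_sqr_ge1 (n : nat) : (0 < n)%N ->
  1 <= \sum_(d <- divisors (n ^ 2)) chi d.
Proof.
elim/pfactor_ind: n / => [|p k m pr _ cop m0 IH].
  by rewrite [divisors _]/= big_seq1 chi1.
rewrite expnMn -expnM sumM ?coprimeXr ?expn_gt0 ?m0 // muln2.
by rewrite mulr_ege1 //; case: (sum_pow p k).
Qed.

End QuadraticDivisorSum.

(** * Summation tools *)

Lemma abel_bound (R : realDomainType) (a b : nat -> R) (C : R) (m n : nat) :
  (forall k, `|\sum_(m <= i < k) a i| <= C) ->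
  (forall i, (m <= i)%N -> 0 <= b i.+1 <= b i) ->
  `|\sum_(m <= i < n) a i * b i| <= C * b m.
Proof.
move=> hA hb.
have b0 i : (m <= i)%N -> 0 <= b i by move=> /hb /andP[]; apply: le_trans.
have C0 : 0 <= C by apply: le_trans (hA 0%N); rewrite normr_ge0.
have [nm|mn] := leqP n m; first by rewrite big_geq // normr0 mulr_ge0 // b0.
(* Removing the boundary term of the summation by parts makes the induction close: each step adds a
   partial sum of [a] times [b n - b n.+1], and these nonnegative differences telescope. *)
suff key : `|\sum_(m <= i < n) a i * b i - (\sum_(m <= i < n) a i) * b n|
    <= C * (b m - b n).
  have bn0 := b0 _ (ltnW mn).
  have h : `|(\sum_(m <= i < n) a i) * b n| <= C * b n.
    by rewrite normrM (ger0_norm bn0) ler_wpM2r.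
  have := lerD key h; rewrite mulrBr subrK; apply: le_trans.
  by apply: le_trans (ler_normD _ _); rewrite subrK.
elim: n {mn}(ltnW mn) => [|n IH] mn.
  by rewrite !big_geq // mul0r subrr normr0 mulr_ge0 // subr_ge0; have -> : m = 0%N by lia.
have [->|/eqP nm] := m =P n.+1.
  by rewrite !big_geq // mul0r !subrr normr0 mulr0.
have {}mn : (m <= n)%N by lia.
have -> : \sum_(m <= i < n.+1) a i * b i - (\sum_(m <= i < n.+1) a i) * b n.+1 =
   (\sum_(m <= i < n) a i * b i - (\sum_(m <= i < n) a i) * b n) +
   (\sum_(m <= i < n.+1) a i) * (b n - b n.+1).
  by rewrite !big_nat_recr //=; ring.
have /andP[_ bn] := hb n mn.
have -> : C * (b m - b n.+1) = C * (b m - b n) + C * (b n - b n.+1) by ring.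
apply: le_trans (ler_normD _ _) (lerD (IH mn) _).
by rewrite normrM (ger0_norm (_ : 0 <= b n - b n.+1)) ?ler_wpM2r ?subr_ge0.
Qed.

Lemma cauchy_seq_cvg (R : realType) (u : nat -> R) :
  (forall e, 0 < e -> exists m, forall n, (m <= n)%N -> `|u n - u m| <= e) ->
  exists l : R, (u @ \oo --> l)%classic.
Proof.
move=> h; exists (limn u).
have : cauchy (u @ \oo)%classic.
  apply: cauchy_exP => e e0; have [m hm] := h (e / 2) (divr_gt0 e0 (ltr0n _ 2)).
  exists (u m); exists m => // n /= /hm hn.
  rewrite /ball /= distrC; apply: le_lt_trans hn _; lra.
by move/cauchy_cvgP.
Qed.

(** The explicit rate matters as much as the limit: both Monsky's argument and Mertens' method use
    the size of the error at each [m]. *)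
Lemma tail_bound_limit (R : realType) (u e : nat -> R) :
  (e @ \oo --> (0 : R))%classic ->
  (forall m n, (m <= n)%N -> `|u n - u m| <= e m) ->
  exists l, forall m, `|l - u m| <= e m.
Proof.
move=> e0 h.
have [l ul] : exists l : R, (u @ \oo --> l)%classic.
  apply: cauchy_seq_cvg => eps eps0.
  have /cvgrPdist_lt /(_ _ eps0) [N _ hN] := e0.
  exists N => n Nn; apply: le_trans (h _ _ Nn) _.
  have := hN N (leqnn N); rewrite /= sub0r normrN => /ltW.
  exact: le_trans (ler_norm _).
exists l => m.
have cv : ((fun n => `|u n - u m|) @ \oo --> `|l - u m|)%classic.
  by apply: cvg_norm; apply: cvgB => //; exact: cvg_cst.
by apply: (cvgr_to_le cv); exists m => // n /= /h.
Qed.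

Lemma bernoulli (R : realDomainType) (t : R) (n : nat) :
  0 <= t -> t <= 1 -> 1 - n%:R * t <= (1 - t) ^+ n.
Proof.
move=> t0 t1; elim: n => [|n IH]; first by rewrite mul0r subr0 expr0.
have := ler_wpM2l (_ : 0 <= 1 - t) IH; rewrite exprS subr_ge0 => /(_ t1).
apply: le_trans; rewrite -natr1 -subr_ge0.
have -> : (1 - t) * (1 - n%:R * t) - (1 - (n%:R + 1) * t) = n%:R * t ^+ 2 by ring.
by rewrite mulr_ge0 // sqr_ge0.
Qed.

Section GeometricSums.

Variables (R : realFieldType) (y : R).
Hypotheses (y0 : 0 < y) (y1 : y < 1).
(** Taking the variable as a square supplies its square root: the geometric mean of
    [1, x, ..., x ^ (n - 1)] is [y ^ (n - 1)]. *)
Let x := y ^+ 2.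
Let s (n : nat) := \sum_(0 <= i < n) x ^+ i.

Let s1 (n : nat) : (0 < n)%N -> 1 <= s n.
Proof.
case: n => // n _; rewrite /s big_nat_recl // expr0 lerDl sumr_ge0 // => i _.
by rewrite exprn_ge0 // sqr_ge0.
Qed.

(* Pair the terms i and n - 1 - i and apply AM-GM. *)
Let s_ge (n : nat) : n%:R * y ^+ n.-1 <= s n.
Proof.
have e : \sum_(0 <= i < n) (x ^+ i + x ^+ (n.-1 - i)) = 2 * s n.
  rewrite big_split /= mulr_natl mulr2n; congr (_ + _).
  rewrite [RHS]big_nat_rev /=; apply: eq_big_nat => i /andP[_ hi].
  by congr (_ ^+ _); lia.
suff : 2 * (n%:R * y ^+ n.-1) <= 2 * s n by rewrite ler_pM2l.
rewrite -e mulrCA mulr_natl -[X in _ *+ X]subn0 -sumr_const_nat.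
apply: ler_sum_nat => i /andP[_ hi].
have -> : n.-1 = (i + (n.-1 - i))%N by lia.
rewrite addKn /x -!exprM !(mulnC 2) !exprM exprD -subr_ge0.
set a := y ^+ i; set b := y ^+ _.
have -> : a ^+ 2 + b ^+ 2 - 2 * (a * b) = (a - b) ^+ 2 by ring.
exact: sqr_ge0.
Qed.

(** As [s n = (1 - x ^ n) / (1 - x)], this is [1 - x] times Monsky's weight
    [1 / (n (1 - x)) - x ^ n / (1 - x ^ n)]; this form avoids the singularity at [x = 1]. *)
Definition lambert_gap (n : nat) : R := n%:R^-1 - x ^+ n / s n.

(** Over a common denominator the decrease amounts to [n (n + 1) x ^ n <= s n s(n + 1)]. The AM-GM
    bounds give the right side at least [n (n + 1) y ^ (2 n - 1)], and [y < 1]. *)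
Lemma lambert_gap_mono (n : nat) : (0 < n)%N ->
  0 <= lambert_gap n.+1 <= lambert_gap n.
Proof.
move=> n0; have sn := s1 n n0; have sn1 := s1 n.+1 isT.
have yi i : y ^+ i <= 1 by rewrite exprn_ile1 // ltW.
have yi0 i : 0 <= y ^+ i by rewrite exprn_ge0 // ltW.
apply/andP; split.
  rewrite subr_ge0 ler_pdivrMr; last lra.
  rewrite ler_pdivlMl ?ltr0n //; apply: le_trans (s_ge _).
  rewrite ler_wpM2l // /x -exprM /=.
  by apply: ler_wiXn2l; rewrite ?ltW //; lia.
rewrite -subr_ge0 /lambert_gap.
have nz : (n%:R : R) != 0 by rewrite pnatr_eq0; lia.
have n1z : (n.+1%:R : R) != 0 by rewrite pnatr_eq0.
have es : s n.+1 = 1 + x * s n.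
  rewrite /s big_nat_recl // expr0 mulr_sumr; congr (_ + _).
  by apply: eq_bigr => i _; rewrite exprS.
have -> : n%:R^-1 - x ^+ n / s n - (n.+1%:R^-1 - x ^+ n.+1 / s n.+1) =
  (s n * s n.+1 - n%:R * n.+1%:R * x ^+ n) / (n%:R * n.+1%:R * (s n * s n.+1)).
  rewrite exprS; move: n1z; rewrite -natr1 => n1z.
  have h1 : s n.+1 != 0 by lra.
  have h2 : s n != 0 by lra.
  rewrite es in h1 *; field.
  by rewrite nz n1z h2 h1.
apply: divr_ge0; last by rewrite !mulr_ge0 //; lra.
rewrite subr_ge0; apply: le_trans (ler_pM _ _ (s_ge n) (s_ge n.+1)).
- rewrite mulrACA -exprD ler_wpM2l ?mulr_ge0 // /x -exprM.
  by apply: ler_wiXn2l; rewrite ?ltW //; lia.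
- by rewrite mulr_ge0.
- by rewrite mulr_ge0.
Qed.

End GeometricSums.

(** * Nonvanishing of L(1, chi) *)

Section LSeries.

Variables (R : realType) (chi : nat -> R) (C : R).
Hypotheses (chi1 : chi 1%N = 1) (chiM : forall m n, chi (m * n)%N = chi m * chi n)
  (chi_val : forall n, [\/ chi n = 0, chi n = 1 | chi n = -1])
  (chi_bd : forall m n, `|\sum_(m <= i < n) chi i| <= C).

Let C0 : 0 <= C.
Proof. by apply: le_trans (chi_bd 0 0); rewrite normr_ge0. Qed.

Let chi_norm (n : nat) : `|chi n| <= 1.
Proof. by case: (chi_val n) => ->; rewrite ?normrN ?normr0 ?normr1. Qed.

Lemma Lseries_tail : exists L : R, forall N,
  `|L - \sum_(1 <= n < N.+1) chi n / n%:R| <= C / N.+1%:R.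
Proof.
apply: tail_bound_limit => [|m n mn].
  rewrite -[0](mulr0 C); apply: cvgM; first exact: cvg_cst.
  exact: cvg_harmonic.
rewrite (@big_cat_nat _ _ _ m.+1) //= addrAC subrr add0r.
apply: abel_bound => // i mi; rewrite invr_ge0 ler0n /=.
by rewrite lef_pV2 ?ler_nat // posrE ltr0n; lia.
Qed.

(** Group the terms by the divisor [d]: the inner geometric sum stops at [N %/ d], whence the second
    power in the numerator, and the factor [1 - x] turns the denominator [1 - x ^ d] into a finite
    geometric sum. *)
Let lambert_identity (y : R) (N : nat) : 0 < y -> y < 1 ->
  (1 - y ^+ 2) * \sum_(1 <= n < N.+1) (\sum_(d <- divisors n) chi d) * (y ^+ 2) ^+ n =
  \sum_(1 <= d < N.+1) chi d *
    (((y ^+ 2) ^+ d - (y ^+ 2) ^+ (d * (N %/ d).+1)) / \sum_(0 <= i < d) (y ^+ 2) ^+ i).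
Proof.
move=> y0 y1; set x := y ^+ 2.
have x0 : 0 < x by rewrite exprn_gt0.
have x1 : x < 1 by rewrite exprn_ilt1 // ltW.
clearbody x; have -> : \sum_(1 <= n < N.+1) (\sum_(d <- divisors n) chi d) * x ^+ n =
    \sum_(1 <= n < N.+1) \sum_(d <- divisors n) chi d * (x ^+ d) ^+ (n %/ d).
  apply: eq_big_nat => n /andP[n0 _]; rewrite mulr_suml; apply: eq_big_seq => d.
  by rewrite -dvdn_divisors // => dn; rewrite -exprM mulnC divnK.
rewrite (sum_divisors_exchange _ (fun d m => chi d * (x ^+ d) ^+ m)) mulr_sumr.
apply: eq_big_nat => d /andP[d0 _]; rewrite -mulr_sumr mulrCA; congr (_ * _).
set s := \sum_(0 <= i < d) x ^+ i.
have s1 : 1 <= s.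
  rewrite /s; case: (d) d0 => // k _; rewrite big_nat_recl // expr0 lerDl sumr_ge0 // => i _.
  by rewrite exprn_ge0 // ltW.
have es : 1 - x ^+ d = (1 - x) * s.
  by rewrite -[LHS]opprK opprB subrX1 /s big_mkord -mulNr opprB.
have geo k : (1 - x ^+ d) * \sum_(1 <= m < k.+1) (x ^+ d) ^+ m = x ^+ d - x ^+ (d * k.+1).
  elim: k => [|k IH]; first by rewrite big_geq // mulr0 muln1 subrr.
  by rewrite big_nat_recr //= mulrDr IH -!exprM [in X in _ = _ - X]mulnS exprD; ring.
apply: (canRL (mulfK _)); first lra.
by rewrite -geo es; ring.
Qed.

(* Monsky: [sum_d chi(d) x^d / (1 - x^d) = sum_n f(n) x^n] with [f = 1 * chi >= 0].  If L = 0,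
   subtracting [sum_d chi(d) / (d (1 - x))] leaves a series with decreasing weights, which
   stays bounded as [x -> 1], although [f(m ^ 2) >= 1]. *)
Lemma Lseries_neq0 (L : R) :
  (forall N, `|L - \sum_(1 <= n < N.+1) chi n / n%:R| <= C / N.+1%:R) -> L != 0.
Proof.
move=> hL; apply/eqP => L0; rewrite {}L0 in hL.
pose f n := \sum_(d <- divisors n) chi d.
have f0 n : (0 < n)%N -> 0 <= f n by move=> n0; exact: sum_divisors_ge0.
have bound (y : R) (M : nat) : 0 < y -> y < 1 ->
    y ^+ (2 * M) * \sum_(1 <= n < M.+1) f n <= C.
  move=> y0 y1; pose x := y ^+ 2.
  have x0 : 0 < x by rewrite exprn_gt0.
  have x1 : x < 1 by rewrite exprn_ilt1 // ltW.
  have xi0 i : 0 <= x ^+ i by rewrite exprn_ge0 // ltW.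
  have x1' : 0 <= 1 - x by rewrite subr_ge0 ltW.
  have y1' : 0 <= 1 - y by rewrite subr_ge0 ltW.
  suff : (1 - x) * (y ^+ (2 * M) * \sum_(1 <= n < M.+1) f n) <= (1 - x) * C + 0.
    by rewrite addr0 ler_pM2l // subr_gt0.
  (* The two errors that disappear as [N] grows: the partial sum of the series with limit [L = 0],
     and the remainders left by truncating the Lambert series. *)
  pose e (N : nat) : R := C * (N.+1%:R)^-1 + (1 - y)^-1 * y ^+ N.
  have e0 : ((fun N => (1 - x) * C + e N) @ \oo --> (1 - x) * C + 0)%classic.
    apply: cvgD; first exact: cvg_cst.
    rewrite -[0](addr0 0) -[X in (_ --> X + _)%classic](mulr0 C).
    rewrite -[X in (_ --> _ + X)%classic](mulr0 (1 - y)^-1).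
    apply: cvgD; apply: cvgM; try exact: cvg_cst; first exact: cvg_harmonic.
    by apply: cvg_expr; rewrite ger0_norm // ltW.
  apply: (cvgr_to_ge e0); exists M => // N /= MN.
  apply: (@le_trans _ _ ((1 - x) * \sum_(1 <= n < N.+1) f n * x ^+ n)).
    rewrite ler_wpM2l // [X in _ <= X](@big_cat_nat _ _ _ M.+1) //=.
    rewrite mulr_sumr -[X in X <= _]addr0; apply: lerD.
      apply: ler_sum_nat => n /andP[n0 nM]; rewrite mulrC ler_wpM2l ?f0 // exprM.
      by apply: ler_wiXn2l; rewrite ?ltW.
    rewrite big_seq_cond sumr_ge0 // => n; rewrite andbT mem_index_iota => /andP[n0 _].
    by rewrite mulr_ge0 // f0 //; lia.
  rewrite lambert_identity // -/x.
  pose s d := \sum_(0 <= i < d) x ^+ i.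
  have s1 d : (0 < d)%N -> 1 <= s d.
    case: d => // d _; rewrite /s big_nat_recl // expr0 lerDl sumr_ge0 // => i _.
  have -> : \sum_(1 <= d < N.+1) chi d * ((x ^+ d - x ^+ (d * (N %/ d).+1)) / s d) =
      \sum_(1 <= d < N.+1) chi d / d%:R - \sum_(1 <= d < N.+1) chi d * lambert_gap _ y d -
      \sum_(1 <= d < N.+1) chi d * (x ^+ (d * (N %/ d).+1) / s d).
    by rewrite -!sumrB; apply: eq_bigr => d _; rewrite /lambert_gap -/x -/(s d); ring.
  have h1 : \sum_(1 <= d < N.+1) chi d / d%:R <= C * (N.+1%:R)^-1.
    by apply: le_trans (hL N); rewrite sub0r normrN ler_norm.
  have h2 : - \sum_(1 <= d < N.+1) chi d * lambert_gap _ y d <= C * (1 - x).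
    have -> : 1 - x = lambert_gap _ y 1.
      by rewrite /lambert_gap big_nat1 expr0 expr1 invr1 mulr1.
    apply: le_trans (abel_bound _ chi (lambert_gap _ y) C 1 N.+1 (chi_bd 1) _).
      by rewrite -normrN ler_norm.
    by move=> i i0; exact: lambert_gap_mono.
  have h3 : - \sum_(1 <= d < N.+1) chi d * (x ^+ (d * (N %/ d).+1) / s d) <=
      (1 - y)^-1 * y ^+ N.
    apply: (@le_trans _ _ (\sum_(1 <= d < N.+1) x ^+ N)).
      rewrite -sumrN; apply: ler_sum_nat => d /andP[d0 _].
      apply: le_trans (ler_norm _) _; rewrite normrN normrM.
      have sd := s1 d d0.
      apply: le_trans (_ : 1 * (x ^+ (d * (N %/ d).+1) / s d) <= _).
        have q0 : 0 <= x ^+ (d * (N %/ d).+1) / s d by apply: divr_ge0 => //; lra.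
        by rewrite (ger0_norm q0) ler_wpM2r.
      rewrite mul1r ler_pdivrMr; last lra.
      apply: le_trans (_ : x ^+ N * 1 <= _); last by rewrite ler_wpM2l.
      rewrite mulr1; apply: ler_wiXn2l; rewrite ?ltW //.
      by rewrite mulnC ltnW // ltn_ceil.
    (* Split [x ^ N = y ^ N y ^ N]: one factor absorbs the count, as [N y ^ N] is at most
       [1 + y + ... + y ^ (N - 1) <= 1 / (1 - y)], and the other one still tends to [0]. *)
    rewrite sumr_const_nat subSS subn0 -mulr_natl /x -exprM mul2n -addnn exprD mulrA.
    have yN0 : 0 <= y ^+ N by rewrite exprn_ge0 // ltW.
    rewrite ler_wpM2r // -[X in _ <= X]mul1r ler_pdivlMr ?subr_gt0 //.
    apply: (@le_trans _ _ ((1 - y) * \sum_(i < N) y ^+ i)).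
      rewrite mulrC ler_wpM2l // mulr_natl -[X in _ *+ X](card_ord N) -sumr_const.
      by apply: ler_sum => i _; apply: ler_wiXn2l; rewrite ?ltW //; exact: ltnW.
    have -> : (1 - y) * \sum_(i < N) y ^+ i = 1 - y ^+ N.
      by rewrite -[RHS]opprB subrX1 -mulNr opprB.
    by rewrite lerBlDr lerDl.
  have h := lerD (lerD h1 h2) h3.
  by apply: le_trans h _; rewrite /e (mulrC C (1 - x)) [X in X + _]addrC addrA.
have sq K : K%:R <= \sum_(1 <= n < (K ^ 2).+1) f n.
  elim: K => [|K IH]; first by rewrite big_geq.
  rewrite (@big_cat_nat _ _ _ (K ^ 2).+1) //=; last by rewrite ltnS leq_exp2r.
  rewrite -natr1 lerD // big_nat_recr /=; last by rewrite ltn_exp2r.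
  rewrite -[X in X <= _]add0r lerD ?sum_divisors_sqr_ge1 //.
  rewrite big_seq_cond sumr_ge0 // => n; rewrite andbT mem_index_iota => /andP[n0 _].
  by rewrite f0 //; lia.
pose K := (Num.bound (2 * C)).+1.
have hK : 2 * C < K%:R.
  apply: lt_le_trans (archi_boundP (_ : 0 <= 2 * C)) _; first by rewrite mulr_ge0.
  by rewrite ler_nat.
pose M := (K ^ 2)%N.
have M0 : (0 < M)%N by rewrite expn_gt0.
(* Chosen so that Bernoulli gives [(1 - t) ^ (2 M) >= 1 - 2 M t = 1/2]. The [K] squares up to
   [M = K ^ 2] then force [K / 2 <= C], against [2 C < K]. *)
pose t : R := (4 * M%:R)^-1.
have M0' : 0 < M%:R :> R by rewrite ltr0n.
have t0 : 0 < t by rewrite invr_gt0 mulr_gt0.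
have t1 : t < 1.
  rewrite invf_lt1 ?mulr_gt0 //; have : 1 <= M%:R :> R by rewrite ler1n.
  lra.
have := bound (1 - t) M (_ : 0 < 1 - t) (_ : 1 - t < 1).
rewrite subr_gt0 t1 ltrBlDr ltrDl t0 => /(_ isT isT).
apply/negP; rewrite -ltNge; apply: lt_le_trans (_ : 2^-1 * K%:R <= _); first lra.
apply: ler_pM; rewrite ?ler0n ?sq //.
apply: le_trans (bernoulli _ t (2 * M) (ltW t0) (ltW t1)).
rewrite natrM /t; have -> : 2 * M%:R * (4 * M%:R)^-1 = 2^-1 :> R.
  by field; lra.
lra.
Qed.

End LSeries.

(** * Chebyshev's bound *)

(** A single prime divisor characterizes prime powers; [0] and [1] have none and get the value
    [0]. *)
Definition von_mangoldt (R : realType) (n : nat) : R :=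
  if primes n is [:: p] then ln p%:R else 0.

Section VonMangoldt.

Variable R : realType.
Local Notation Lam := (@von_mangoldt R).

Lemma von_mangoldt_ge0 (n : nat) : 0 <= Lam n.
Proof.
rewrite /von_mangoldt; case e: (primes n) => [|p [|]] //.
rewrite ln_ge0 // ler1n prime_gt0 //.
by have := mem_primes p n; rewrite e inE eqxx => /esym/andP[].
Qed.

Lemma von_mangoldt_pfactor (p k : nat) : prime p -> (0 < k)%N -> Lam (p ^ k) = ln p%:R.
Proof. by move=> pr k0; rewrite /von_mangoldt primesX // primes_prime. Qed.

Lemma von_mangoldt_cases (n : nat) : Lam n = 0 \/
  exists p k, [/\ prime p, (0 < k)%N, n = (p ^ k)%N & Lam n = ln p%:R].
Proof.
have [n0|n0] := posnP n; first by left; rewrite n0.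
case e: (primes n) => [|p [|p' l]]; try by left; rewrite /von_mangoldt e.
right; have pn : p \in primes n by rewrite e mem_head.
have pr : prime p by move: pn; rewrite mem_primes => /andP[].
exists p, (logn p n); split=> //; last by rewrite /von_mangoldt e.
  by rewrite logn_gt0.
by rewrite {1}(prod_prime_decomp n0) prime_decompE e /= big_seq1.
Qed.

(** Among the divisors [p ^ i.+1 * e] with [e] dividing [m], only [e = 1] counts, since any other
    [e] brings in a second prime; the [k] values of [i] then contribute [k ln p]. *)
Lemma sum_von_mangoldt (n : nat) : (0 < n)%N -> \sum_(d <- divisors n) Lam d = ln n%:R.
Proof.
elim/pfactor_ind: n / => [|p k m pr k0 cop m0 IH].
  by rewrite [divisors 1]/= big_seq1 ln1.
rewrite sum_divisors_pfactor // big_nat_recl //.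
have -> : \sum_(e <- divisors m) Lam (p ^ 0 * e) = ln m%:R.
  by rewrite -IH; apply: eq_bigr => e _; rewrite mul1n.
have -> : \sum_(0 <= i < k) \sum_(e <- divisors m) Lam (p ^ i.+1 * e) =
    \sum_(0 <= i < k) ln p%:R.
  apply: eq_bigr => i _; rewrite (perm_big (1%N :: rem 1%N (divisors m))) /=; last first.
    by apply: perm_to_rem; rewrite divisor1.
  rewrite big_cons muln1 von_mangoldt_pfactor // big_seq big1 ?addr0 //.
  move=> e; rewrite mem_rem_uniq ?divisors_uniq // inE -dvdn_divisors // => /andP[/= e1 em].
  have e0 := dvdn_gt0 m0 em.
  case: (von_mangoldt_cases (p ^ i.+1 * e)) => // -[q [j [pq j0 E _]]].
  have pe : (p %| q)%N.
    have : (p %| q ^ j)%N by rewrite -E expnS -mulnA dvdn_mulr.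
    by rewrite Euclid_dvdX // => /andP[].
  move: pe; rewrite dvdn_prime2 // => /eqP pq'.
  have e2 : (1 < e)%N by lia.
  have : (pdiv e %| q ^ j)%N.
    by rewrite -E dvdn_mull // pdiv_dvd.
  rewrite Euclid_dvdX ?pdiv_prime // => /andP[].
  rewrite dvdn_prime2 ?pdiv_prime // -pq' => /eqP de _.
  have : (p %| m)%N by apply: dvdn_trans em; rewrite -de pdiv_dvd.
  by move=> pm; move: cop; rewrite prime_coprime // pm.
have p0 : 0 < p%:R :> R by rewrite ltr0n prime_gt0.
rewrite sumr_const_nat subn0 natrM natrX lnM ?posrE ?ltr0n ?exprn_gt0 //.
by rewrite lnXn // addrC.
Qed.

(** The logarithm of the central binomial coefficient is the sum of [Lam d] with weights
    [2n %/ d - 2 (n %/ d)], which are nonnegative, and at least [1] for [n < d <= 2n]. As that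
    coefficient is at most [4 ^ n] and [ln 2 <= 1], doubling [n] adds at most [2 n]. *)
Lemma psi_bound (N : nat) : \sum_(1 <= d < N.+1) Lam d <= 4 * N%:R.
Proof.
pose T N : R := \sum_(1 <= n < N.+1) ln n%:R.
have TE N' M : (N' <= M)%N -> T N' = \sum_(1 <= d < M.+1) Lam d * (N' %/ d)%:R.
  move=> NM; rewrite [RHS](@big_cat_nat _ _ _ N'.+1) //=.
  rewrite [X in _ + X]big_nat_cond [X in _ + X]big1 ?addr0; last first.
    by move=> d /andP[/andP[h _] _]; rewrite divn_small // mulr0.
  have -> : T N' = \sum_(1 <= n < N'.+1) \sum_(d <- divisors n) Lam d.
    by apply: eq_big_nat => n /andP[n0 _]; rewrite sum_von_mangoldt.
  rewrite (sum_divisors_exchange _ (fun d m => Lam d)).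
  by apply: eq_bigr => d _; rewrite sumr_const_nat subSS subn0 mulr_natr.
have TF N' : T N' = ln (N'`!)%:R.
  elim: N' => [|n IH]; first by rewrite /T big_geq // ln1.
  rewrite /T big_nat_recr //= -/(T n) IH factS natrM lnM ?posrE ?ltr0n ?fact_gt0 //.
  by rewrite addrC.
have step n : \sum_(1 <= d < (n.*2).+1) Lam d <= \sum_(1 <= d < n.+1) Lam d + 2 * n%:R.
  have h : T n.*2 - 2 * T n <= 2 * n%:R.
    have -> : T n.*2 - 2 * T n = ln 'C(n.*2, n)%:R.
      rewrite !TF -(@bin_fact n.*2 n) -addnn ?leq_addr // addnK.
      rewrite !natrM !lnM ?posrE ?mulr_gt0 ?ltr0n ?fact_gt0 ?bin_gt0 ?leq_addr //.
      by ring.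
    have : ln ('C(n.*2, n)%:R : R) <= ln (2 ^ n.*2)%:R.
      rewrite ler_ln ?posrE ?ltr0n ?bin_gt0 ?expn_gt0 -?addnn ?leq_addr // ler_nat.
      rewrite -[X in (_ <= X ^ _)%N]/((1 + 1)%N) expnDn.
      rewrite (bigD1 (inord n : 'I_(n + n).+1)) //= inordK ?ltnS ?leq_addr //.
      by rewrite !exp1n !muln1 leq_addr.
    rewrite natrX lnXn ?ltr0n // -mul2n -[ln _ *+ _]mulr_natl natrM => /le_trans; apply.
    have l2 : ln (2%:R : R) <= 1.
      by have -> : 2%:R = 1 + 1 :> R; [ring | apply: le_ln1Dx; lra].
    by rewrite -[X in _ <= X]mulr1 ler_wpM2l.
  suff : \sum_(1 <= d < (n.*2).+1) Lam d - \sum_(1 <= d < n.+1) Lam d <= T n.*2 - 2 * T n.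
    by move=> h2; lra.
  rewrite (TE _ _ (leqnn n.*2)) (TE n n.*2) -?addnn ?leq_addr // addnn.
  rewrite mulr_sumr -sumrB.
  have -> : \sum_(1 <= d < (n.*2).+1) Lam d - \sum_(1 <= d < n.+1) Lam d =
     \sum_(1 <= d < (n.*2).+1) (if (n < d)%N then Lam d else 0).
    rewrite !(@big_cat_nat _ _ _ n.+1 1 (n.*2).+1) //= -?addnn ?ltnS ?leq_addr //.
    rewrite addrAC subrr add0r [X in _ = X + _]big_nat_cond [X in _ = X + _]big1 ?add0r.
      by apply: eq_big_nat => d /andP[-> _].
    by move=> d /andP[/andP[_ h'] _]; rewrite ltnNge -ltnS h'.
  apply: ler_sum_nat => d /andP[d0 dn].
  have -> : Lam d * (n.*2 %/ d)%:R - 2 * (Lam d * (n %/ d)%:R) =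
    Lam d * ((n.*2 %/ d)%:R - (2 * (n %/ d))%:R) by rewrite natrM; ring.
  have L0 := von_mangoldt_ge0 d.
  have le2 : (2 * (n %/ d) <= n.*2 %/ d)%N.
    by rewrite leq_divRL // -mulnA -mul2n leq_mul2l /= leq_divM.
  case: ifP => nd; last by rewrite mulr_ge0 // subr_ge0 ler_nat.
  rewrite (divn_small nd) muln0 subr0 ler_peMr // ler1n divn_gt0 //.
have mono m n : (m <= n)%N -> \sum_(1 <= d < m.+1) Lam d <= \sum_(1 <= d < n.+1) Lam d.
  move=> mn; rewrite [X in _ <= X](@big_cat_nat _ _ _ m.+1) //= lerDl sumr_ge0 // => d _.
  exact: von_mangoldt_ge0.
have [k] := ubnP N; elim: k N => // k IH N Nk.
have [N2|N2] := leqP N 1.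
  case: N N2 {Nk} => [|[|//]] _; first by rewrite big_geq // mulr0.
  by rewrite big_nat1 /von_mangoldt /=; lra.
(* Rounding up keeps [N <= 2 m]. The induction gives [4 m + 2 m], which is at most [4 N] because
   [3 m <= 2 N] once [N >= 2]. *)
pose m := uphalf N.
have mN : (m < N)%N by rewrite /m; lia.
have Nm : (N <= m.*2)%N by rewrite /m; lia.
apply: le_trans (mono _ _ Nm) _; apply: le_trans (step m) _.
have : (3 * m <= 2 * N)%N by rewrite /m; lia.
rewrite -(ler_nat R) !natrM => h3; have := IH m (leq_trans mN (ltnSE Nk)).
lra.
Qed.

End VonMangoldt.

(** * Sums over primes *)

Lemma exists_nat_gt (R : realType) (x : R) : exists n : nat, x < n%:R.
Proof.
exists (Num.bound `|x|); apply: le_lt_trans (ler_norm x) _.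
exact: archi_boundP.
Qed.

(** The function [ln x / x] decreases only beyond [e], so the threshold exceeds [expR 1]; there
    [ln i >= 1] outweighs the increment [ln (1 + 1 / i) <= 1 / i]. *)
Lemma ln_div_mono (R : realType) : exists n0 : nat, (0 < n0)%N /\
  forall i, (n0 <= i)%N -> 0 <= ln (i.+1%:R : R) / i.+1%:R <= ln i%:R / i%:R.
Proof.
have [n0 hn0] := exists_nat_gt R (expR 1).
exists n0; split=> [|i n0i].
  by rewrite -(ltr_nat R); apply: lt_trans hn0; rewrite expR_gt0.
have i0 : 0 < i%:R :> R.
  apply: lt_le_trans (_ : n0%:R <= _); last by rewrite ler_nat.
  by apply: lt_trans hn0; rewrite expR_gt0.
have i0' : (0 < i)%N by rewrite -(ltr_nat R).
have li : 1 <= ln (i%:R : R).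
  rewrite -[X in X <= _](@expRK R) ler_ln ?posrE ?expR_gt0 //.
  by apply: le_trans (ltW hn0) _; rewrite ler_nat.
apply/andP; split; first by rewrite divr_ge0 // ln_ge0 // ler1n.
rewrite ler_pdivrMr ?ltr0n // mulrAC ler_pdivlMr // -natr1.
have -> : i%:R + 1 = i%:R * (1 + i%:R^-1) :> R by rewrite mulrDr mulr1 mulfV ?gt_eqF.
have iV : 0 < i%:R^-1 :> R by rewrite invr_gt0.
rewrite lnM ?posrE ?addr_gt0 // mulrDl.
have h : ln (1 + i%:R^-1 : R) <= i%:R^-1 by apply: le_ln1Dx; lra.
have : ln (1 + i%:R^-1 : R) * i%:R <= 1.
  by apply: le_trans (ler_wpM2r (ltW i0) h) _; rewrite mulVf ?gt_eqF.
move=> h'; rewrite mulrDr mulr1 mulrDr mulfV ?gt_eqF // mulr1.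
by rewrite lerD2l (le_trans h').
Qed.

Lemma geometric_tail_le (R : realFieldType) (t : R) (N : nat) : 0 <= t -> t <= 2^-1 ->
  \sum_(2 <= k < N) t ^+ k <= 2 * t ^+ 2.
Proof.
move=> t0 t2.
have [N2|/ltnW N2] := leqP N 2; first by rewrite big_geq // mulr_ge0 // sqr_ge0.
(* The extra term stands for the remaining tail; [2 t ^ N.+1 <= t ^ N] makes the left side
   nonincreasing in [N]. *)
suff : \sum_(2 <= k < N) t ^+ k + 2 * t ^+ N <= 2 * t ^+ 2.
  by apply: le_trans; rewrite lerDl mulr_ge0 // exprn_ge0.
elim: N N2 => // N IH N2; have [N1|N1] := eqVneq N 1%N.
  by rewrite N1 big_geq // add0r.
rewrite big_nat_recr /=; last by lia.
apply: le_trans (IH _); last by lia.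
rewrite -addrA lerD2l exprS; have := exprn_ge0 N t0; nra.
Qed.

Lemma sum_ln_sqr_le (R : realType) (N : nat) :
  \sum_(2 <= n < N) ln (n%:R : R) / n%:R ^+ 2 <= 2.
Proof.
(* [ln n / n ^ 2 <= g n - g (n - 1)], as [x |-> - (2 + ln x) / x] has a derivative
   slightly larger than [ln x / x ^ 2]. *)
pose g n : R := - ((2 + ln n%:R) / n%:R).
have [N2|/ltnW N2] := leqP N 2; first by rewrite big_geq.
case: N N2 => // N N1.
have -> : 2 = - g 1%N :> R by rewrite /g ln1 addr0 divr1 opprK.
apply: le_trans (_ : g N - g 1%N <= _); last first.
  by rewrite gerDr oppr_le0 divr_ge0 // addr_ge0 // ln_ge0 // ler1n.
rewrite -telescope_sumr // big_add1 /=; apply: ler_sum_nat => n /andP[n0 _].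
have nR : 0 < n%:R :> R by rewrite ltr0n.
have n1R : 1 <= n%:R :> R by rewrite ler1n.
have nV : 0 < n%:R^-1 :> R by rewrite invr_gt0.
have ln0 : 0 <= ln (n%:R : R) by rewrite ln_ge0.
have h : ln (1 + n%:R^-1 : R) <= n%:R^-1 by apply: le_ln1Dx; lra.
have e : ln (n.+1%:R : R) = ln n%:R + ln (1 + n%:R^-1).
  rewrite -lnM ?posrE ?addr_gt0 //; congr ln.
  by rewrite mulrDr mulr1 mulfV ?gt_eqF // natr1.
have u0 : 0 <= ln (1 + n%:R^-1 : R) by rewrite ln_ge0 // lerDl ltW.
rewrite /g e -natr1; move: (ln (1 + _)) h u0 => u h u0.
move: (ln _) ln0 => v v0; move: (n%:R) nR n1R nV h => x x0 x1 xV h.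
have hx : x * u <= 1.
  by apply: le_trans (ler_wpM2l (ltW x0) h) _; rewrite mulfV ?gt_eqF.
rewrite -subr_ge0.
have -> : - ((2 + (v + u)) / (x + 1)) - - ((2 + v) / x) - (v + u) / (x + 1) ^+ 2 =
  (2 * (x + 1) + v - u * x * (x + 2)) / (x * (x + 1) ^+ 2).
  by field; rewrite !gt_eqF //; lra.
apply: divr_ge0; last by rewrite mulr_ge0 ?sqr_ge0 // ltW.
nra.
Qed.

Section PrimeSums.

Variables (R : realType) (chi : nat -> R) (C : R).
Hypotheses (chi1 : chi 1%N = 1) (chiM : forall m n, chi (m * n)%N = chi m * chi n)
  (chi_val : forall n, [\/ chi n = 0, chi n = 1 | chi n = -1])
  (chi_bd : forall m n, `|\sum_(m <= i < n) chi i| <= C).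
Local Notation Lam := (@von_mangoldt R).

Let C0 : 0 <= C.
Proof. by apply: le_trans (chi_bd 0 0); rewrite normr_ge0. Qed.

Let chi_norm (n : nat) : `|chi n| <= 1.
Proof. by case: (chi_val n) => ->; rewrite ?normrN ?normr0 ?normr1. Qed.

Let chi_ln_bounded : exists B : R, forall N,
  `|\sum_(1 <= n < N.+1) chi n * (ln n%:R / n%:R)| <= B.
Proof.
have [n0 [n00 mono]] := ln_div_mono R.
exists (\sum_(1 <= n < n0) `|chi n * (ln n%:R / n%:R)| + C * (ln n0%:R / n0%:R)) => N.
have [Nn|nN] := leqP N.+1 n0.
  rewrite (@big_cat_nat _ _ _ N.+1 1 n0) //= -addrA.
  apply: le_trans (ler_norm_sum _ _ _) _; rewrite lerDl addr_ge0 ?sumr_ge0 // mulr_ge0 //.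
  by rewrite divr_ge0 // ln_ge0 // ler1n.
rewrite (@big_cat_nat _ _ _ n0 1 N.+1) //=; last exact: ltnW.
apply: le_trans (ler_normD _ _) (lerD (ler_norm_sum _ _ _) _).
exact: abel_bound.
Qed.

(** Expand [chi n ln n / n] over [n = d m] by [Lam * 1 = ln]. Each inner sum over [m] is [L] up to
    [C / (N %/ d).+1], which after division by [d] is at most [C / N]; by Chebyshev these errors
    total at most [4 C]. Dividing by [L != 0] gives the bound. *)
Lemma chi_von_mangoldt_bounded : exists B : R, forall N,
  `|\sum_(1 <= d < N.+1) chi d * Lam d / d%:R| <= B.
Proof.
have [L hL] := Lseries_tail _ _ _ chi_bd.
have L0 := Lseries_neq0 _ _ _ chi1 chiM chi_val chi_bd _ hL.
have [B hB] := chi_ln_bounded.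
exists ((B + 4 * C) / `|L|) => N.
rewrite ler_pdivlMr ?normr_gt0 // -normrM.
have [->|N0] := posnP N.
  rewrite big_geq // mul0r normr0 addr_ge0 ?mulr_ge0 //.
  by apply: le_trans (hB 0%N); rewrite normr_ge0.
have e : \sum_(1 <= n < N.+1) chi n * (ln n%:R / n%:R) =
   \sum_(1 <= d < N.+1) chi d * Lam d / d%:R * \sum_(1 <= m < (N %/ d).+1) chi m / m%:R.
  under [RHS]eq_bigr do rewrite mulr_sumr.
  rewrite -(sum_divisors_exchange _ (fun d m => chi d * Lam d / d%:R * (chi m / m%:R))).
  apply: eq_big_nat => n /andP[n0 _]; rewrite -sum_von_mangoldt // mulr_suml mulr_sumr.
  apply: eq_big_seq => d; rewrite -dvdn_divisors // => dn.
  have d0 := dvdn_gt0 n0 dn.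
  have nd : (0 < n %/ d)%N by rewrite divn_gt0 // dvdn_leq.
  rewrite -{1 2}(divnK dn) chiM natrM; field.
  by rewrite !pnatr_eq0 -!lt0n d0 nd.
have -> : (\sum_(1 <= d < N.+1) chi d * Lam d / d%:R) * L =
  \sum_(1 <= n < N.+1) chi n * (ln n%:R / n%:R) +
  \sum_(1 <= d < N.+1) chi d * Lam d / d%:R * (L - \sum_(1 <= m < (N %/ d).+1) chi m / m%:R).
  by rewrite e -big_split mulr_suml; apply: eq_bigr => d _ /=; rewrite -mulrDr addrC subrK.
apply: le_trans (ler_normD _ _) (lerD (hB N) _).
apply: le_trans (ler_norm_sum _ _ _) _.
apply: le_trans (_ : \sum_(1 <= d < N.+1) Lam d * (C / N%:R) <= _).
  apply: ler_sum_nat => d /andP[d0 _]; rewrite -!mulrA !normrM.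
  have Ld := von_mangoldt_ge0 R d.
  rewrite (ger0_norm Ld) -[X in _ <= X]mul1r; apply: ler_pM => //.
    by rewrite !mulr_ge0.
  rewrite ler_wpM2l // normfV normr_nat.
  have dR : 0 < d%:R :> R by rewrite ltr0n.
  apply: le_trans (ler_wpM2l _ (hL _)) _; first by rewrite invr_ge0.
  rewrite mulrCA ler_wpM2l // -invfM lef_pV2 ?posrE ?mulr_gt0 ?ltr0n //.
  by rewrite -natrM ler_nat mulnC ltnW // ltn_ceil.
rewrite -mulr_suml; have CN0 : 0 <= C / N%:R by rewrite divr_ge0.
apply: le_trans (ler_wpM2r CN0 (psi_bound R N)) _.
by rewrite -mulrA [N%:R * _]mulrCA divff ?mulr1 // pnatr_eq0; lia.
Qed.

(** Enlarging the bases to all integers [p >= 2], the exponents [k >= 2] contribute at most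
    [2 ln p / p ^ 2] for each [p], and the sum of [ln p / p ^ 2] is at most [2]. *)
Lemma prime_powers_bounded (N : nat) :
  \sum_(1 <= n < N.+1 | ~~ prime n) Lam n / n%:R <= 4.
Proof.
have bd n : (n <= N)%N -> ~~ prime n ->
   Lam n <= \sum_(2 <= p < N.+1) \sum_(2 <= k < N.+1) (if n == (p ^ k)%N then ln p%:R else 0).
  move=> nN npr.
  have ge0 p k : 0 <= (if n == (p ^ k)%N then ln p%:R else 0 : R).
    by case: ifP => // _; case: p => [|p]; [rewrite ln0 | rewrite ln_ge0 // ler1n].
  case: (von_mangoldt_cases R n) => [->|[p [k [pr k0 e ->]]]].
    by rewrite sumr_ge0 // => p _; rewrite sumr_ge0.
  have p1 := prime_gt1 pr.
  have k2 : (2 <= k)%N.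
    by case: k k0 e => [|[|k]] // _ e; move: npr; rewrite e expn1 pr.
  have kn : (k < n)%N by rewrite e ltn_expl.
  have pn : (p <= n)%N by rewrite e -{1}(expn1 p) leq_exp2l.
  rewrite (bigD1_seq p) ?iota_uniq ?mem_index_iota //=; last by lia.
  rewrite (bigD1_seq k) ?iota_uniq ?mem_index_iota //=; last by lia.
  rewrite {1}e eqxx -addrA lerDl addr_ge0 ?sumr_ge0 // => i _; rewrite sumr_ge0 //.
apply: le_trans (_ : \sum_(1 <= n < N.+1) \sum_(2 <= p < N.+1) \sum_(2 <= k < N.+1)
   (if n == (p ^ k)%N then ln p%:R / (p ^ k)%:R else 0 : R) <= _).
  rewrite big_mkcond; apply: ler_sum_nat => n /andP[n0 nN].
  have ge0 : 0 <= \sum_(2 <= p < N.+1) \sum_(2 <= k < N.+1)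
      (if n == (p ^ k)%N then ln p%:R / (p ^ k)%:R else 0 : R).
    rewrite big_seq_cond sumr_ge0 // => p; rewrite andbT mem_index_iota => /andP[p2 _].
    rewrite sumr_ge0 // => k _; case: ifP => // _.
    by rewrite divr_ge0 // ln_ge0 // ler1n; lia.
  case: ifP => // npr; rewrite ler_pdivrMr ?ltr0n //.
  apply: le_trans (bd n nN npr) _; rewrite mulr_suml le_eqVlt; apply/orP; left; apply/eqP.
  apply: eq_bigr => p _; rewrite mulr_suml; apply: eq_bigr => k _.
  by case: eqP => [<-|_]; rewrite ?mul0r // divfK // pnatr_eq0; lia.
rewrite exchange_big /=.
apply: le_trans (_ : \sum_(2 <= p < N.+1) 2 * (ln p%:R / p%:R ^+ 2) <= _); last first.
  rewrite -mulr_sumr; have := sum_ln_sqr_le R N.+1; lra.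
apply: ler_sum_nat => p /andP[p2 _]; rewrite exchange_big /=.
have p0 : 0 < p%:R :> R by rewrite ltr0n; lia.
have lp : 0 <= ln p%:R :> R by rewrite ln_ge0 // ler1n; lia.
apply: le_trans (_ : \sum_(2 <= k < N.+1) ln p%:R * (p%:R^-1) ^+ k <= _).
  apply: ler_sum => k _; rewrite -big_mkcond /=.
  have q0 : 0 <= ln p%:R * p%:R^-1 ^+ k :> R by rewrite mulr_ge0 // exprn_ge0 // invr_ge0 ltW.
  have [pN|pN] := boolP ((p ^ k)%N \in index_iota 1 N.+1).
    rewrite big_mkcond (bigD1_seq (p ^ k)%N) ?iota_uniq //= eqxx big1 ?addr0.
      by rewrite natrX exprVn.
    by move=> i /negPf ->.
  rewrite big_seq_cond big_pred0 // => i; apply/negbTE; apply: contra pN.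
  by move=> /andP[h /eqP <-].
rewrite -mulr_sumr mulrCA ler_wpM2l // -exprVn; apply: geometric_tail_le.
  by rewrite invr_ge0 ltW.
by rewrite lef_pV2 ?posrE ?ler_nat.
Qed.

Lemma chi_prime_ln_bounded : exists B : R, forall N,
  `|\sum_(1 <= n < N.+1) (if prime n then chi n * ln n%:R / n%:R else 0)| <= B.
Proof.
have [B hB] := chi_von_mangoldt_bounded; exists (B + 4) => N.
have -> : \sum_(1 <= n < N.+1) (if prime n then chi n * ln n%:R / n%:R else 0) =
  \sum_(1 <= d < N.+1) chi d * Lam d / d%:R -
  \sum_(1 <= d < N.+1 | ~~ prime d) chi d * (Lam d / d%:R).
  rewrite [X in _ - X]big_mkcond -sumrB; apply: eq_bigr => n _.
  case: ifP => pr /=; last by rewrite mulrA subrr.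
  have -> : Lam n = ln n%:R by rewrite -{1}(expn1 n) von_mangoldt_pfactor.
  by rewrite subr0.
apply: le_trans (ler_normB _ _) (lerD (hB N) _).
apply: le_trans (ler_norm_sum _ _ _) (le_trans _ (prime_powers_bounded N)).
apply: ler_sum => n _; rewrite normrM -[X in _ <= X]mul1r; apply: ler_pM => //.
by rewrite ger0_norm // divr_ge0 // von_mangoldt_ge0.
Qed.

Lemma chi_prime_series_cvg : exists l : R,
  ((fun N => \sum_(0 <= n < N) (if prime n then chi n / n%:R else 0)) @ \oo --> l)%classic.
Proof.
have [B hB] := chi_prime_ln_bounded.
pose a n : R := if prime n then chi n * ln n%:R / n%:R else 0.
have hA m k : (0 < m)%N -> `|\sum_(m <= i < k) a i| <= 2 * B.
  have B0 : 0 <= B by apply: le_trans (hB 0%N); rewrite normr_ge0.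
  move=> m0; have [km|mk] := leqP k m; first by rewrite big_geq // normr0 mulr_ge0.
  have h := big_cat_nat (n := m) (m := 1%N) (p := k) (F := a) (P := xpredT)
    (op := +%R) (idx := 0) m0 (ltnW mk).
  have -> : \sum_(m <= i < k) a i = \sum_(1 <= i < k) a i - \sum_(1 <= i < m) a i.
    by rewrite h addrAC subrr add0r.
  rewrite mulr_natl mulr2n; apply: le_trans (ler_normB _ _) _.
  by rewrite -(prednK m0) -(prednK (leq_ltn_trans (leq0n _) mk)) lerD // hB.
apply: cauchy_seq_cvg => eps eps0.
(* Abel summation against the weights [1 / ln i] bounds the tail from [m] by [2 B / ln m], which
   this threshold brings below [eps]; the maximum with [2] keeps [ln m] positive. *)
have [m0 hm] := exists_nat_gt R (expR (2 * B / eps)).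
pose m := maxn m0 2; exists m => n mn.
have m2 : (2 <= m)%N by rewrite leq_maxr.
have lm : 2 * B / eps <= ln m%:R.
  rewrite -[X in X <= _]expRK ler_ln ?posrE ?expR_gt0 ?ltr0n; try lia.
  by apply: le_trans (ltW hm) _; rewrite ler_nat leq_maxl.
rewrite (@big_cat_nat _ _ _ m 0 n) //= addrAC subrr add0r.
have lpos i : (2 <= i)%N -> 0 < ln i%:R :> R by move=> i2; rewrite ln_gt0 // ltr1n.
have -> : \sum_(m <= i < n) (if prime i then chi i / i%:R else 0) =
    \sum_(m <= i < n) a i * (ln i%:R)^-1.
  apply: eq_bigr => i _; rewrite /a; case: ifP => pr; last by rewrite mul0r.
  have := lpos i (prime_gt1 pr) => l0; rewrite mulrAC mulrK // unitfE gt_eqF //.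
apply: le_trans (abel_bound _ a (fun i => (ln i%:R)^-1) (2 * B) m n _ _) _.
- by move=> k; apply: hA; lia.
- move=> i mi; have i2 : (2 <= i)%N by lia.
  rewrite invr_ge0 ltW ?lpos //=; last by lia.
  by rewrite lef_pV2 ?posrE ?lpos ?ler_ln ?posrE ?ltr0n ?ler_nat //; lia.
by rewrite ler_pdivrMr ?lpos // -ler_pdivrMl // mulrC.
Qed.

End PrimeSums.

(** * The Euler product *)

(** Both sides come from [ln (1 + x) <= x], at [x = -v] and at [x = v / (1 - v)], where [1 + x] is
    the inverse of [1 - v]. *)
Lemma ln_1B_bound (R : realType) (v : R) : `|v| <= 2^-1 -> `|ln (1 - v) + v| <= 2 * v ^+ 2.
Proof.
rewrite ler_norml => /andP[v1 v2].
have h1 : ln (1 + - v) <= - v by apply: le_ln1Dx; lra.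
have w0 : 0 < 1 - v by lra.
have h2 : ln (1 + v / (1 - v)) <= v / (1 - v).
  by apply: le_ln1Dx; rewrite ltr_pdivlMr //; lra.
have e : 1 + v / (1 - v) = (1 - v)^-1 by field; lra.
rewrite e lnV ?posrE // in h2.
have h3 : v / (1 - v) <= v + 2 * v ^+ 2.
  rewrite ler_pdivrMr //; have := sqr_ge0 v; have := sqr_ge0 v; nra.
rewrite ler_norml; apply/andP; split; first lra.
by have := sqr_ge0 v; lra.
Qed.

Lemma summable_of_sqr_bound (R : realType) (w : nat -> R) (K : R) :
  (forall n, (2 <= n)%N -> `|w n| <= K / n%:R ^+ 2) ->
  exists l : R, ((fun N => \sum_(0 <= n < N) w n) @ \oo --> l)%classic.
Proof.
move=> hw; apply: cauchy_seq_cvg => eps eps0.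
have K0 : 0 <= K.
  have := le_trans (normr_ge0 _) (hw 2 isT); rewrite pmulr_lge0 // invr_gt0.
  by rewrite exprn_gt0.
have [k hk] := exists_nat_gt R (K / eps).
exists k.+2 => n kn; rewrite (@big_cat_nat _ _ _ k.+2 0 n) //= addrAC subrr add0r.
apply: (@le_trans _ _ (K * (k.+1%:R^-1))); last first.
  rewrite ler_pdivrMr ?ltr0n // -ler_pdivrMl // mulrC (le_trans (ltW hk)) // ler_nat; lia.
apply: le_trans (ler_norm_sum _ _ _) _.
(* Telescoping majorant: [K / i ^ 2 <= K / (i - 1) - K / i = g i.+1 - g i]. Starting at [k.+2]
   leaves the total bound [K / k.+1]. *)
pose g n : R := - (K / n.-1%:R).
apply: (@le_trans _ _ (\sum_(k.+2 <= i < n) (g i.+1 - g i))).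
  apply: ler_sum_nat => i /andP[ki _]; have i2 : (2 <= i)%N by lia.
  apply: le_trans (hw i i2) _; rewrite /g /=.
  have i0 : 0 < i%:R :> R by rewrite ltr0n; lia.
  have ei : i.-1%:R = i%:R - 1 :> R by rewrite -subn1 natrB //; lia.
  have i1 : 0 < i%:R - 1 :> R by rewrite -ei ltr0n; lia.
  rewrite ei -mulNr mulNr opprK addrC -mulrBr ler_wpM2l //.
  have -> : (i%:R - 1)^-1 - i%:R^-1 = (i%:R * (i%:R - 1))^-1 :> R.
    by field; rewrite !gt_eqF.
  by rewrite lef_pV2 ?posrE ?mulr_gt0 ?exprn_gt0 //; nra.
rewrite telescope_sumr // /g opprK /= addrC gerDl oppr_le0 divr_ge0 //.
Qed.

Lemma euler_product_cvg (R : realType) (chi : nat -> R) (P : pred nat) (K : nat) (l : R) :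
  (forall n, `|chi n| <= 1) ->
  ((fun N => \sum_(0 <= n < N) (if prime n then chi n / n%:R else 0)) @ \oo --> l)%classic ->
  (forall p, P p -> prime p && (2 < p)%N) ->
  (forall p, prime p -> ~~ P p -> (p <= K)%N) ->
  exists2 L : R, L != 0 &
   ((fun N => \prod_(0 <= p < N | P p) (1 - chi p / (p%:R - 1))) @ \oo --> L)%classic.
Proof.
move=> chi_norm hl Pprime PK.
pose v n : R := if P n then chi n / (n%:R - 1) else 0.
pose z n : R := if prime n then chi n / n%:R else 0.
have v_bd n : `|v n| <= 2^-1.
  rewrite /v; case: ifP => [/Pprime/andP[_ n2]|_]; last by rewrite normr0 invr_ge0.
  have n3 : 3 <= n%:R :> R by rewrite ler_nat.
  rewrite normrM normfV (ger0_norm (_ : 0 <= n%:R - 1)); last lra.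
  by rewrite ler_pdivrMr; have := chi_norm n; lra.
have v1 n : 0 < 1 - v n by have := v_bd n; rewrite ler_norml => /andP[]; lra.
(* In [10 = 8 + 2], [8] comes from the quadratic error of the logarithm with [|v n| <= 2 / n], and
   [2] from replacing [n - 1] by [n]. The term [K] covers the omitted primes, where
   [1 / n <= K / n ^ 2]. *)
have wbd n : (2 <= n)%N -> `|ln (1 - v n) + z n| <= (10 + K%:R) / n%:R ^+ 2.
  move=> n2; have nR : 2 <= n%:R :> R by rewrite ler_nat.
  have n0 : 0 < n%:R :> R by lra.
  have nn0 : 0 < n%:R ^+ 2 :> R by rewrite exprn_gt0.
  have K0 : 0 <= K%:R :> R by [].
  have cn := chi_norm n.
  case Pn: (P n); last first.
    rewrite /v Pn subr0 ln1 add0r /z; case: ifP => pr; last first.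
      by rewrite normr0 divr_ge0 // ?addr_ge0 // ltW.
    have nK : n%:R <= K%:R :> R by rewrite ler_nat PK ?Pn.
    rewrite normrM normfV (ger0_norm (ltW n0)) ler_pdivlMr // expr2 mulrA divfK ?gt_eqF //.
    nra.
  have /andP[pr _] := Pprime n Pn.
  have -> : ln (1 - v n) + z n = (ln (1 - v n) + v n) - chi n / (n%:R * (n%:R - 1)).
    by rewrite /v /z Pn pr; field; rewrite !gt_eqF //; lra.
  apply: le_trans (ler_normB _ _) _.
  apply: (@le_trans _ _ (8 / n%:R ^+ 2 + 2 / n%:R ^+ 2)); last first.
    by rewrite -mulrDl ler_wpM2r ?invr_ge0 ?sqr_ge0 //; lra.
  have h : (n%:R - 1)^-1 <= 2 / n%:R :> R.
    by rewrite -[X in X <= _]mul1r ler_pdivlMr // mulrAC ler_pdivrMr; lra.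
  have h0 : 0 <= (n%:R - 1)^-1 :> R by rewrite invr_ge0; lra.
  apply: lerD.
    apply: le_trans (ln_1B_bound _ _ (v_bd n)) _; rewrite /v Pn.
    have -> : 8 / n%:R ^+ 2 = 2 * (2 / n%:R) ^+ 2 :> R by field; rewrite gt_eqF.
    rewrite ler_wpM2l // -real_normK ?num_real // lerXn2r ?nnegrE ?divr_ge0 //.
    rewrite normrM normfV (ger0_norm (_ : 0 <= n%:R - 1)); last lra.
    by apply: le_trans h; rewrite -[X in _ <= X]mul1r ler_wpM2r.
  rewrite normrM normfV (ger0_norm (_ : 0 <= n%:R * (n%:R - 1))); last nra.
  apply: (@le_trans _ _ (1 * (n%:R * (n%:R - 1))^-1)).
    by rewrite ler_wpM2r // invr_ge0; nra.
  rewrite mul1r invfM.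
  have -> : 2 / n%:R ^+ 2 = n%:R^-1 * (2 / n%:R) :> R by field; rewrite gt_eqF.
  by rewrite ler_wpM2l // invr_ge0 ltW.
have [m hm] := summable_of_sqr_bound _ _ _ wbd.
exists (expR (m - l)); first by rewrite gt_eqF ?expR_gt0.
have -> : (fun N => \prod_(0 <= p < N | P p) (1 - chi p / (p%:R - 1))) =
   (fun N => expR (\sum_(0 <= n < N) (ln (1 - v n) + z n) - \sum_(0 <= n < N) z n)).
  apply/funext => N; rewrite -sumrB expR_sum big_mkcond; apply: eq_bigr => n _.
  rewrite addrK lnK ?posrE // /v; case: ifP => // _; by rewrite subr0.
apply: continuous_cvg; first exact: continuous_expR.
exact: cvgB.
Qed.

Section LegendreCharacter.

Variables (R : realType) (q : nat).
Hypotheses (pq : prime q) (q4 : (q = 3 %[mod 4])%N).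
Let chi (n : nat) : R := (legendre n%:Z q)%:~R.

Let q2 : (2 < q)%N. Proof. lia. Qed.

Lemma legendre_char1 : chi 1 = 1.
Proof. by rewrite /chi legendre1. Qed.

Lemma legendre_charM (m n : nat) : chi (m * n) = chi m * chi n.
Proof. by rewrite /chi PoszM legendreM // intrM. Qed.

Lemma legendre_char_val (n : nat) : [\/ chi n = 0, chi n = 1 | chi n = -1].
Proof.
rewrite /chi; case: (legendre_cases n q) => ->;
  [by constructor 1|by constructor 2|by constructor 3; rewrite rmorphN1].
Qed.

Let chi_norm (n : nat) : `|chi n| <= 1.
Proof. by case: (legendre_char_val n) => ->; rewrite ?normrN ?normr0 ?normr1. Qed.

Let chiD (n : nat) : chi (n + q) = chi n.
Proof.
congr (_%:~R); apply: legendre_mod => //.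
by rewrite PoszD addrAC subrr add0r.
Qed.

Let sum_period : \sum_(0 <= i < q) chi i = 0.
Proof.
have c0 : chi 0 = 0.
  by rewrite /chi; have /eqP -> : legendre 0%N q == 0 by rewrite legendre_eq0 dvdz0.
rewrite big_ltn ?prime_gt0 // c0 add0r.
set S := \sum_(1 <= i < q) _; suff : S = - S by lra.
rewrite {1}/S big_nat_rev -sumrN /=; apply: eq_big_nat => i /andP[i0 iq].
rewrite add1n subSS /chi -rmorphN -legendreN //; congr (_%:~R).
apply: legendre_mod => //.
by have -> : (q - i)%N%:Z - - i%:Z = q by lia.
Qed.

(** Full periods cancel, as [i -> q - i] changes the sign of [chi], so initial sums stay within [q];
    the factor [2] comes from subtracting two of them. *)
Lemma legendre_char_bound (m n : nat) : `|\sum_(m <= i < n) chi i| <= 2 * q%:R.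
Proof.
have init N : `|\sum_(0 <= i < N) chi i| <= q%:R.
  rewrite (divn_eq N q); elim: (N %/ q)%N => [|k IH].
    rewrite add0n; apply: le_trans (ler_norm_sum _ _ _) _.
    apply: le_trans (_ : \sum_(0 <= i < N %% q) 1 <= _); first by apply: ler_sum.
    by rewrite sumr_const_nat subn0 ler_nat ltnW // ltn_pmod // prime_gt0.
  rewrite mulSn -addnA (@big_cat_nat _ _ _ q) ?leq_addr //= sum_period add0r.
  rewrite -{1}(add0n q) big_addn addKn.
  by under eq_bigr => i _ do rewrite chiD.
have [nm|/ltnW mn] := leqP n m; first by rewrite big_geq // normr0 mulr_ge0.
have -> : \sum_(m <= i < n) chi i = \sum_(0 <= i < n) chi i - \sum_(0 <= i < m) chi i.
  by rewrite (@big_cat_nat _ _ _ m 0 n) //= addrAC subrr add0r.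
rewrite mulr_natl mulr2n; apply: le_trans (ler_normB _ _) (lerD _ _); exact: init.
Qed.

Lemma h_const_product_cvg (r : int) : r != 0 -> exists2 L : R, L != 0 &
  ((fun n : nat => \prod_(0 <= p < n | prime p && ~~ (p%:Z %| 2 * r)%Z)
      (1 - (legendre (- q%:Z) p)%:~R / (p%:R - 1))) @ \oo --> L)%classic.
Proof.
move=> r0; have [l hl] := chi_prime_series_cvg _ _ _ legendre_char1 legendre_charM
  legendre_char_val legendre_char_bound.
have P2 p : prime p && ~~ (p%:Z %| 2 * r)%Z -> prime p && (2 < p)%N.
  move=> /andP[pr h]; rewrite pr /=; case: (ltngtP p 2) => //.
    by have := prime_gt1 pr; lia.
  by move=> p2; move: h; rewrite p2 dvdz_mulr.
have PK p : prime p -> ~~ (prime p && ~~ (p%:Z %| 2 * r)%Z) -> (p <= 2 * `|r|)%N.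
  move=> pr; rewrite pr /= negbK dvdzE abszM => /dvdn_leq; apply.
  by rewrite muln_gt0 !absz_gt0 r0.
have [L L0 hL] := euler_product_cvg _ _ _ _ _ chi_norm hl P2 PK.
exists L => //; apply: cvg_trans hL; apply: near_eq_cvg; apply: nearW => n /=.
apply: eq_bigr => p /P2 /andP[pr p2]; congr (1 - _%:~R / _).
by rewrite legendre_reciprocity.
Qed.

End LegendreCharacter.

(** * Comparison of the constants *)

Lemma h_constN (R : realType) (D : nat) (r : int) : h_const R D (- r) = h_const R D r.
Proof.
rewrite /h_const /xi !dvdzE abszN; congr (_ * _); congr (lim (_ @ \oo))%classic; apply/funext => n.
by apply: eq_bigl => p; rewrite !dvdzE mulrN abszN.
Qed.

Lemma h_const_eq0 (R : realType) (D : nat) (r : int) :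
  prime D -> (D = 3 %[mod 4])%N -> r != 0 -> (h_const R D r == 0) = (xi R D r == 0).
Proof.
move=> pD D4 r0; have [L L0 hL] := h_const_product_cvg R D pD D4 r r0.
have D0 := prime_gt0 pD.
rewrite /h_const (cvg_lim _ hL) // !mulf_eq0 (negPf L0) orbF invr_eq0.
have -> : (Num.sqrt D%:R == 0 :> R) = false by rewrite sqrtr_eq0 leNgt ltr0n D0.
by rewrite pnatr_eq0 eqn0Ngt totient_gt0 D0 !orbF.
Qed.

Lemma Omega2N (R : realType) (D g1 : nat) (r : int) : Omega2 R D g1 (- r) = Omega2 R D g1 r.
Proof. by apply: eq_bigl => p; rewrite !dvdzE abszN. Qed.

(** Odd [g1] has only prime factors [p >= 3], so each denominator is at least [3 - 1 - 1 = 1]. *)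
Lemma Omega2_neq0 (R : realType) (D g1 : nat) (r : int) : odd g1 -> Omega2 R D g1 r != 0.
Proof.
move=> og; rewrite /Omega2 prodf_seq_neq0; apply/allP => p.
rewrite mem_primes => /and3P[pr g0 pg]; apply/implyP => _.
have p2 : (2 < p)%N.
  case: (ltngtP p 2) => //; first by have := prime_gt1 pr; lia.
  by move=> p2; move: pg; rewrite p2 dvdn2 og.
have p3 : 3 <= p%:R :> R by rewrite ler_nat.
apply: mulf_neq0; first by rewrite oppr_eq0 oner_eq0.
rewrite invr_eq0; case: (legendre_cases (- D%:Z) p) => ->; rewrite ?rmorphN1;
  by rewrite gt_eqF //; lra.
Qed.

(** Only the branch [4 %| r] involves [r] beyond its class modulo [4]; there part of the exponent
    changes sign, harmlessly because [-1] is its own inverse. *)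
Lemma epsN (R : realType) (delta lambda mu g1 : nat) (r : int) :
  eps R delta lambda mu g1 (- r) = eps R delta lambda mu g1 r.
Proof.
rewrite /eps; have -> : (- r == 2 %[mod 4])%Z = (r == 2 %[mod 4])%Z by lia.
have -> : (4 %| - r)%Z = (4 %| r)%Z by lia.
case: ifP => // _; case: ifP => // r4.
have N1 : (-1 : R) != 0 by rewrite oppr_eq0 oner_eq0.
have [k ->] := dvdzP r4.
rewrite !expfzDr //; congr (_ * _).
rewrite -mulNr !mulrA !mulzK // mulrN.
by rewrite -exprz_inv invrN1.
Qed.

Lemma signr_sum_eq0 (R : numDomainType) (a b : nat) :
  ((-1) ^+ a + (-1) ^+ b == 0 :> R) = odd (a + b).
Proof.
rewrite -(signr_odd R a) -(signr_odd R b) oddD.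
case: (odd a); case: (odd b); rewrite ?expr0 ?expr1 ?addNr ?addrN ?eqxx //.
  by rewrite -opprD oppr_eq0 paddr_eq0 // oner_eq0.
by rewrite paddr_eq0 // oner_eq0.
Qed.

Lemma eps_eq0 (R : realType) (delta lambda mu g1 : nat) (r : int) :
  (eps R delta lambda mu g1 r == 0) =
  if (2 %| r)%Z then (r == 2 %[mod 4])%Z && odd lambda
  else odd lambda || odd (delta + mu + (g1 - 1) %/ 2).
Proof.
have N1 : (-1 : R) != 0 by rewrite oppr_eq0 oner_eq0.
have lam : (1 + (-1) ^+ lambda == 0 :> R) = odd lambda.
  by rewrite -{1}(expr0 (-1)) signr_sum_eq0.
rewrite /eps; case: ifP => r2.
  have -> : (2 %| r)%Z by lia.
  by rewrite !mulf_eq0 oner_eq0 invr_eq0 pnatr_eq0 lam expf_eq0 (negPf N1) andbF.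
case: ifP => r4.
  have -> : (2 %| r)%Z by lia.
  by rewrite expfz_eq0 (negPf N1) andbF.
have -> : (2 %| r)%Z = false by lia.
by rewrite !mulf_eq0 oner_eq0 invr_eq0 pnatr_eq0 lam signr_sum_eq0 addnC.
Qed.

Lemma xi_eq0 (R : realType) (D : nat) (r : int) : D \in cm_discs ->
  (xi R D r == 0) = ~~ (2 %| r)%Z && (D == 7)%N.
Proof.
rewrite /xi; case: ifP => _ hD /=; first by rewrite oner_eq0.
move: hD; rewrite !inE.
by case/orP=> [/eqP->|/orP[/eqP->|/orP[/eqP->|/orP[/eqP->|/orP[/eqP->|/eqP->]]]]];
  rewrite /= ?eqxx ?pnatr_eq0.
Qed.

(** The two sides differ by exactly [h e x W]. *)
Lemma half_affine_eq (F : numFieldType) (h e x W : F) : x != 0 -> W != 0 ->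
  h / 2 * (1 + e * x * W) = h / 2 * (1 + e * - x * W) <-> (h == 0) || (e == 0).
Proof.
move=> x0 W0.
have -> : (h == 0) || (e == 0) = (h * (e * x * W) == 0).
  by rewrite !mulf_eq0 (negPf x0) (negPf W0) !orbF.
have -> : h * (e * x * W) = h / 2 * (1 + e * x * W) - h / 2 * (1 + e * - x * W) by field.
by rewrite subr_eq0; split=> /eqP.
Qed.

Theorem theorem7p14 (R : realType) (D : nat) (r g : int) (E : wcurve)
  (delta lambda mu g1 : nat)
  (hD : D \in [:: 7; 11; 19; 43; 67; 163]%N)
  (hr : r != 0) (hg : g != 0)
  (hE : E = cm_curve D g)
  (hdelta : (delta <= 1)%N) (hg1 : (1 <= g1)%N)
  (hcop : coprime g1 (2 * D))
  (hdec : g = (-1) ^+ delta * 2 ^+ lambda * D%:Z ^+ mu * g1%:Z) :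
  varpi R E r = varpi R E (- r) <->
    (D%:Z %| r)%Z
    \/ (D = 7%N /\ gcdz r 14 = 1)
    \/ ((r = 2 %[mod 4])%Z /\ ~ (2 %| lambda)%N /\ ~ (D%:Z %| r)%Z)
    \/ (~ (2 %| r * lambda%:Z)%Z /\ ~ (D%:Z %| r)%Z)
    \/ (~ (2 %| r * (delta + mu + (g1 - 1) %/ 2)%N%:Z)%Z /\ ~ (D%:Z %| r)%Z).
Proof.
have [edelta elambda emu eg1] := g_decomp_uniq hD hdelta hg1 hcop hdec.
have /andP[pD oD] := cm_disc_prime hD.
have D4 : (D = 3 %[mod 4])%N.
  by move: hD; rewrite !inE;
    case/orP=> [/eqP->|/orP[/eqP->|/orP[/eqP->|/orP[/eqP->|/orP[/eqP->|/eqP->]]]]].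
have D2 : (2 < D)%N by lia.
move: hcop; rewrite coprimeMr coprimen2 => /andP[og1 cD].
rewrite hE /varpi cm_paramsE //= -edelta -elambda -emu -eg1.
have -> : (D%:Z %| - r)%Z = (D%:Z %| r)%Z by rewrite !dvdzE abszN.
have [Dr|nDr] := boolP (D%:Z %| r)%Z; first by split=> // _; left.
rewrite h_constN Omega2N epsN mulrN legendreN // rmorphN /=.
set h := h_const R D r; set e := eps _ _ _ _ _ _; set W := Omega2 _ _ _ _.
set x := (legendre _ D)%:~R : R.
have x0 : x != 0.
  rewrite intr_eq0 !legendreM // !mulf_neq0 // legendre_eq0 //.
    rewrite (dvdz_pcharf (pchar_Fp pD)) rmorphXn expf_neq0 //=.
    rewrite -pmulrn -(dvdn_pcharf (pchar_Fp pD)) dvdn_prime2 //; lia.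
  by rewrite dvdzE /= -prime_coprime // coprime_sym.
have W0 : W != 0 := Omega2_neq0 R D g1 r og1.
apply: (iff_trans (half_affine_eq _ _ _ _ _ x0 W0)).
rewrite h_const_eq0 // xi_eq0 // eps_eq0.
have r2 : (2 %| r)%Z = ~~ odd `|r| by rewrite dvdzE dvdn2.
have rM k : (2 %| r * k%:Z)%Z = ~~ (odd `|r| && odd k).
  by rewrite dvdzE abszM dvdn2 oddM.
(* In this branch [D] does not divide [r], so for [D = 7] coprimality to [7] is automatic and only
   the parity of [r] remains. *)
have gcd14 : D = 7%N -> gcdz r 14 = 1 <-> odd `|r|.
  move=> D7; have c7 : coprime `|r| 7.
    by rewrite coprime_sym prime_coprime // -D7.
  rewrite -coprimen2; have -> : gcdz r 14 = gcdn `|r| (2 * 7) by [].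
  split=> [[/eqP]|h']; first by rewrite -/(coprime _ _) coprimeMr => /andP[].
  by congr Posz; apply/eqP; rewrite -/(coprime _ _) coprimeMr h'.
have r4 : (r == 2 %[mod 4])%Z -> odd `|r| = false by move=> h4; lia.
rewrite r2 !rM dvdn2 negbK.
split=> [/orP[/andP[ro /eqP D7]|]|].
- by right; left; split=> //; apply/gcd14.
- case: (odd `|r|) => /= [/orP[lo|so]|/andP[/eqP h4 lo]].
  + by do 3 right; left; rewrite lo; split=> //; apply/negP.
  + by do 4 right; rewrite so; split=> //; apply/negP.
  + by do 2 right; left; rewrite lo; do !split=> //; apply/negP.
- case=> [//|[[D7 /gcd14 ro]|[[h4 [lo _]]|[[lo _]|[lo _]]]]].
  + by rewrite ro // D7 eqxx.
  + move/eqP in h4; rewrite (r4 h4) h4 /=.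
    by case: (odd lambda) lo.
  + by move: lo; case: (odd `|r|); case: (odd lambda); rewrite ?orbT.
  + by move: lo; case: (odd `|r|); case: (odd (_ + _ + _)); rewrite ?orbT.
Qed.
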